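(* Let $Q \subset \mathbb{R}^n$ be a unit cube. Let $\mu$ be a probability measure on $Q$ whose density is both log-concave and convex in $Q$. Then for any measurable $A \subseteq \mathbb{R}^n$ and $t > 0$, $$ \mu(A) \geq 1/2 \quad \Longrightarrow \quad \mu \left( A + t B^n \right) \geq 1 - \exp \left(- t^2 / 9 \right). $$
   Context: A unit cube is a cube of sidelength one. A non-negative function $f$ is log-concave if $-\log f$ is convex (as a function with values in $(-\infty,+\infty]$). $|\cdot|$ is the Euclidean norm, $B^n = \{x \in \mathbb{R}^n : |x| \leq 1\}$, and $A + tB^n = \{x + t y : x \in A,\ y \in B^n\}$. ''Measurable'' means Borel measurable, and densities are with respect to Lebesgue measure. *)

(* Defs.v *)
From HB Require Import structures.
From mathcomp Require Import all_boot all_order all_algebra.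
From mathcomp Require Import all_classical all_reals all_analysis.
From mathcomp Require Import measurable_realfun.
Set Implicit Arguments.
Unset Strict Implicit.
Unset Printing Implicit Defensive.
Import Order.TTheory GRing.Theory Num.Theory.
Import numFieldNormedType.Exports.

Local Open Scope classical_set_scope.
Local Open Scope ring_scope.

Definition borel_rV (R : realType) (n : nat) : Type :=
  g_sigma_algebraType (@open 'rV[R]_n).

HB.instance Definition _ (R : realType) (n : nat) :=
  Measurable.copy (borel_rV R n) (g_sigma_algebraType (@open 'rV[R]_n)).

Section borel_coordinates.
Variable R : realType.

Lemma measurable_fun_coord n (i : 'I_n) :
  measurable_fun setT (fun v : borel_rV R n => (v : 'rV[R]_n) 0 i).
Proof.
apply: (measurability _ (RGenOpens.measurableE R)).
move=> _ [_ [a [b ->]] <-]; rewrite setTI.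
apply: sub_sigma_algebra => /=.
apply: (@open_comp 'rV[R]_n R) => [v _|]; first exact: coord_continuous.
exact: interval_open.
Qed.

Lemma measurable_preimage_box d (T : measurableType d) n
    (f : T -> borel_rV R n) (A : 'I_n -> set R) :
  (forall i, measurable_fun setT (fun x => (f x : 'rV[R]_n) 0 i)) ->
  (forall i, measurable (A i)) ->
  measurable (f @^-1` [set v : 'rV[R]_n | forall i, A i (v 0 i)]).
Proof.
move=> mf mA.
rewrite [X in measurable X](_ : _ = \bigcap_(i in [set: 'I_n])
    ((fun x => (f x : 'rV[R]_n) 0 i) @^-1` A i)); last first.
  by apply/seteqP; split=> [x Ax i _|x Ax i]; apply: Ax.
apply: fin_bigcap_measurable => [|i _]; first exact: finite_finset.
by rewrite -[X in measurable X]setTI; apply: mf.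
Qed.

Lemma measurable_fun_rV d (T : measurableType d) n (f : T -> borel_rV R n) :
  (forall i : 'I_n, measurable_fun setT (fun x => (f x : 'rV[R]_n) 0 i)) ->
  measurable_fun setT f.
Proof.
move=> mf; apply: (@measurability _ _ _ (borel_rV R n) _ _ open) => //.
move=> _ [U oU <-]; rewrite setTI.
pose box (ab : 'rV[rat]_n * 'rV[rat]_n) : set 'rV[R]_n :=
  [set v | forall i, v 0 i \in `]ratr (ab.1 0 i), ratr (ab.2 0 i)[ ].
have -> : f @^-1` U =
    \bigcup_ab (if `[< box ab `<=` U >] then f @^-1` box ab else set0).
  apply/seteqP; split=> [x Ux|x [ab _]]; last first.
    by case: ifPn => // /asboolP; apply.
  have /nbhs_ballP[e /= e0 eU] : nbhs (f x : 'rV[R]_n) U.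
    exact: open_nbhs_nbhs.
  have /(_ _)/cid -/all_sig[a fa] i : exists q : rat,
      ratr q \in `](f x : 'rV[R]_n) 0 i - e, (f x : 'rV[R]_n) 0 i[.
    by apply: rat_in_itvoo; rewrite ltrBlDr ltrDl.
  have /(_ _)/cid -/all_sig[b fb] i : exists q : rat,
      ratr q \in `](f x : 'rV[R]_n) 0 i, (f x : 'rV[R]_n) 0 i + e[.
    by apply: rat_in_itvoo; rewrite ltrDl.
  exists (\row_i a i, \row_i b i) => //.
  rewrite asboolT => [i|v boxv].
    by move: (fa i) (fb i); rewrite !mxE !in_itv/= => /andP[_ ->] /andP[-> _].
  apply: eU; split=> // i j; rewrite ord1.
  move: (boxv j) (fa j) (fb j); rewrite !mxE !in_itv/=.
  move=> /andP[av vb] /andP[ea _] /andP[_ be].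
  rewrite /ball/= distrC ltr_distl.
  by rewrite (lt_trans ea av) (lt_trans vb be).
apply: countable_bigcupT_measurable => [|ab]; first exact: countableP.
case: ifPn => // _.
rewrite [X in measurable X](_ : _ = f @^-1` [set v : 'rV[R]_n | forall i,
    `]ratr (ab.1 0 i), ratr (ab.2 0 i)[%classic (v 0 i)]) //.
exact: (@measurable_preimage_box _ _ _ f
  (fun i => `]ratr (ab.1 0 i), ratr (ab.2 0 i)[%classic)).
Qed.

End borel_coordinates.

Section lebesgue_rV.
Variable R : realType.

Definition cons_rV n (p : borel_rV R n * measurableTypeR R) :
    borel_rV R n.+1 :=
  row_mx (const_mx p.2 : 'rV[R]_1) (p.1 : 'rV[R]_n).

Lemma cons_rV_ord0 n (p : borel_rV R n * measurableTypeR R) :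
  (cons_rV p : 'rV[R]_n.+1) 0 ord0 = p.2.
Proof.
have -> : ord0 = lshift n (0 : 'I_1) by apply/val_inj.
by rewrite /cons_rV (@row_mxEl _ 1 1 n) mxE.
Qed.

Lemma cons_rV_lift n (p : borel_rV R n * measurableTypeR R) (i : 'I_n) :
  (cons_rV p : 'rV[R]_n.+1) 0 (lift ord0 i) = (p.1 : 'rV[R]_n) 0 i.
Proof. by rewrite -rshift1 /cons_rV (@row_mxEr _ 1 1 n). Qed.

Lemma measurable_cons_rV n : measurable_fun setT (@cons_rV n).
Proof.
apply: measurable_fun_rV => i; have [j ->|->] := unliftP ord0 i.
  under eq_fun do rewrite cons_rV_lift.
  exact: (measurableT_comp (@measurable_fun_coord R n j)).
under eq_fun do rewrite cons_rV_ord0.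
exact: measurable_snd.
Qed.

(* Lebesgue measure on R^n as the n-fold product of the one on the line. *)
Fixpoint lebesgue_rV n : set (borel_rV R n) -> \bar R :=
  if n is n'.+1 then
    pushforward (lebesgue_rV (n := n') \x lebesgue_measure)%E (@cons_rV n')
  else \d_ ((0 : 'rV[R]_0) : borel_rV R 0).

Let lebesgue_rV_measure n : exists m : {measure set (borel_rV R n) -> \bar R},
  m = @lebesgue_rV n :> (set _ -> _).
Proof.
elim: n => [|n [m mE]]; first by exists \d_ ((0 : 'rV[R]_0) : borel_rV R 0).
unshelve eexists.
  apply: (measure_function_pushforward__canonical__measure_function_Measure
    (m \x lebesgue_measure)%E).
  exact: measurable_cons_rV.
by rewrite /= mE.
Qed.

Let lebesgue_rV0 n : @lebesgue_rV n set0 = 0%E.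
Proof. by have [m <-] := lebesgue_rV_measure n. Qed.

Let lebesgue_rV_ge0 n A : (0 <= @lebesgue_rV n A)%E.
Proof. by have [m <-] := lebesgue_rV_measure n. Qed.

Let lebesgue_rV_sigma_additive n : semi_sigma_additive (@lebesgue_rV n).
Proof.
have [m <-] := lebesgue_rV_measure n; exact: measure_semi_sigma_additive.
Qed.

HB.instance Definition _ n := isMeasure.Build _ _ _ (@lebesgue_rV n)
  (lebesgue_rV0 n) (@lebesgue_rV_ge0 n) (@lebesgue_rV_sigma_additive n).

Lemma lebesgue_rV_box n (A : 'I_n -> set (measurableTypeR R)) :
  (forall i, measurable (A i)) ->
  lebesgue_rV [set v : 'rV[R]_n | forall i, A i (v 0 i)] =
    (\prod_(i < n) lebesgue_measure (A i))%E.
Proof.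
elim: n A => [|n IHn] A mA.
  rewrite big_ord0 /= diracE mem_set// => -[] //.
rewrite big_ord_recl muleC -IHn// -[RHS]product_measure1E//; last first.
  apply: (@measurable_preimage_box _ _ _ n id (fun i => A (lift ord0 i))) => i.
    exact: measurable_fun_coord.
  exact: mA.
apply: (congr1 (lebesgue_rV (n:=n) \x lebesgue_measure)%E); apply/seteqP.
split=> [[w x] /= Avx|[w x] /= [Aw Ax] i].
  split=> [i|]; first by move: (Avx (lift ord0 i)); rewrite cons_rV_lift.
  by move: (Avx ord0); rewrite cons_rV_ord0.
by have [j ->|->] := unliftP ord0 i; rewrite ?cons_rV_lift ?cons_rV_ord0.
Qed.

End lebesgue_rV.

(* Euclidean norm; the library norm on row vectors is the sup norm. *)
Definition enorm (R : realType) n (v : 'rV[R]_n) : R :=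
  Num.sqrt (\sum_(i < n) v 0 i ^+ 2).

Definition enlargement (R : realType) n (A : set 'rV[R]_n) (t : R) :
    set 'rV[R]_n :=
  [set x + t *: y | x in A & y in [set y | enorm y <= 1]].

(* Closed cubes of arbitrary position and orientation. *)
Definition unit_cube (R : realType) n (Q : set 'rV[R]_n) : Prop :=
  exists (a : 'rV[R]_n) (U : 'M[R]_n), U *m U^T = 1%:M /\
    Q = [set a + u *m U | u in [set u : 'rV[R]_n | forall i, 0 <= u 0 i <= 1]].

(* For functions with values in ]-oo, +oo]; note that 0 * +oo = 0 here. *)
Definition econvex (R : realType) n (D : set 'rV[R]_n)
    (g : 'rV[R]_n -> \bar R) :=
  forall (x y : 'rV[R]_n) (s : R), D x -> D y -> 0 <= s <= 1 ->
    (g (s *: x + (1 - s) *: y)%R <= s%:E * g x + (1 - s)%:E * g y)%E.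

Definition log_concave (R : realType) n (D : set 'rV[R]_n)
    (f : 'rV[R]_n -> R) :=
  econvex D (fun x => - lne (f x)%:E)%E.

(* mu is carried by Q, with density f on Q and 0 elsewhere. *)
Definition has_density (R : realType) n (mu : set (borel_rV R n) -> \bar R)
    (Q : set 'rV[R]_n) (f : 'rV[R]_n -> R) : Prop :=
  [/\ measurable_fun (Q : set (borel_rV R n)) (f : borel_rV R n -> R),
      forall x, Q x -> 0 <= f x
    & forall E : set (borel_rV R n), measurable E ->
        mu E = (\int[@lebesgue_rV R n]_(x in E `&` Q) (f x)%:E)%E ].

(* A Minkowski sum of a Borel set and a closed ball need not be Borel, and a
   [measure] is unconstrained outside the sigma-algebra. On sets measurable for
   the completion of a finite mu, inner_measure mu is the completed measure. *)
Definition inner_measure d (T : measurableType d) (R : realType)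
    (mu : set T -> \bar R) (S : set T) : \bar R :=
  ereal_sup [set mu E | E in [set E | measurable E /\ E `<=` S]].

Lemma inner_measureE d (T : measurableType d) (R : realType)
    (mu : {measure set T -> \bar R}) (S : set T) :
  measurable S -> inner_measure mu S = mu S.
Proof.
move=> mS; apply/eqP; rewrite eq_le; apply/andP; split.
  by apply: ge_ereal_sup => _ [E [mE ES] <-]; rewrite le_measure ?inE.
by apply: ereal_sup_ubound => /=; exists S => //; split => // x.
Qed.

(* Main.v *)
(** The theorem follows from a Prékopa-Leindler inequality with a transport cost.
If [H] is nonnegative and convex on the cube and
[F x * G y <= H ((x + y) / 2)^2 * exp (2/9 |x - y|^2)] there, then
[(int F) (int G) <= (int H)^2].  Take for [H] the density [f], for [G] its
restriction to [A], and for [F] the product of [exp (2/9 t^2)] and the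
restriction of [f] to the points at distance at least [t] from [A]: midpoint
log-concavity gives the hypothesis, and the conclusion reads
[mu (far set) * mu A <= exp (- 2/9 t^2)].

Slicing reduces the inequality to dimension one, because the slice integrals of
a convex function are convex.  In dimension one, transport [F] and [G]
simultaneously by equal masses to points [x] and [y], and write [z] for their
midpoint and [d] for their half-difference, so that [dx dy = dz^2 - dd^2]; with
[exp (u^2 / 9) <= 1 + u^2 / 8] the claim becomes the weighted Poincaré
inequality [int H d^2 dz <= int H (dd/dz)^2 dz], where [d] vanishes at both
ends.  It holds since [H d^2] at a point is at most the integral of
[H (dd/dz)^2] on the side where [H] is larger.  Finite partitions replace the
transport map, so that [F] and [G] need only be measurable. *)

Require Import Defs.
From HB Require Import structures.
From mathcomp Require Import all_boot all_order all_algebra.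
From mathcomp Require Import all_classical all_reals all_analysis.
From mathcomp Require Import measurable_realfun ring lra.
Set Implicit Arguments.
Unset Strict Implicit.
Unset Printing Implicit Defensive.
Import Order.TTheory GRing.Theory Num.Theory.
Import numFieldNormedType.Exports.
Local Open Scope classical_set_scope.
Local Open Scope ring_scope.

(** * A discrete Poincaré inequality *)

(** Cauchy-Schwarz with the interval lengths as weights; total length at most 1 makes the constant
    1. *)
Lemma sqr_increment_le (R : realFieldType) (z d : nat -> R) (a b : nat) :
  (a <= b)%N -> (forall i, (a <= i < b)%N -> z i < z i.+1) -> z b - z a <= 1 ->
  (d b - d a) ^+ 2 <=
    \sum_(a <= i < b) (d i.+1 - d i) ^+ 2 / (z i.+1 - z i).
Proof.
move=> ab zlt zle; set D := d b - d a.
(* Tangent-line bound [e^2 / w >= 2 D e - D^2 w]; its right side sums to at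
   least [D^2]. *)
apply: (@le_trans _ _ (\sum_(a <= i < b)
    (D *+ 2 * (d i.+1 - d i) - D ^+ 2 * (z i.+1 - z i)))).
  rewrite big_split/= sumrN -!mulr_sumr !telescope_sumr// -/D.
  have := sqr_ge0 D; nra.
rewrite big_nat_cond [leRHS]big_nat_cond.
apply: ler_sum => i; rewrite andbT => /zlt; rewrite -subr_gt0 => w0.
rewrite ler_pdivlMr//.
have := sqr_ge0 ((d i.+1 - d i) - D * (z i.+1 - z i)); nra.
Qed.

(** From each [j], [m] stays at least [m j] all the way to one of the ends, where [d] vanishes.
    Cauchy-Schwarz on that side gives [m j * d j ^+ 2 <= T], and weighting by lengths of total at
    most 1 keeps the bound. Samples of a convex function along an increasing sequence satisfy the
    dichotomy on [m]. *)
Lemma discrete_poincare (R : realFieldType) (K : nat) (z d m : nat -> R) :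
  (forall i, (i < K)%N -> z i < z i.+1) -> z K - z 0 <= 1 ->
  d 0 = 0 -> d K = 0 -> (forall i, (i < K)%N -> 0 <= m i) ->
  (forall j, (j < K)%N -> (forall i, (j <= i < K)%N -> m j <= m i) \/
                          (forall i, (i <= j)%N -> m j <= m i)) ->
  \sum_(0 <= i < K) m i * (z i.+1 - z i) * d i ^+ 2 <=
  \sum_(0 <= i < K) m i * ((d i.+1 - d i) ^+ 2 / (z i.+1 - z i)).
Proof.
move=> zlt zle d0 dK m0 mqc; set T := leRHS.
have zmono a b : (a <= b)%N -> (b <= K)%N -> z a <= z b.
  move=> ab bK; rewrite -subr_ge0 -telescope_sumr// big_nat_cond.
  apply: sumr_ge0 => i; rewrite andbT => /andP[_ ib].
  by rewrite subr_ge0 ltW// zlt// (leq_trans ib).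
have e0 i : (i < K)%N -> 0 <= (d i.+1 - d i) ^+ 2 / (z i.+1 - z i).
  by move=> iK; rewrite divr_ge0 ?sqr_ge0// subr_ge0 ltW// zlt.
(* Applied to the index ranges from [j] to [K] and from 0 to [j], where one of [d a], [d b] is
   zero. *)
have part a b j : (a <= b)%N -> (b <= K)%N -> (j < K)%N ->
    (forall i, (a <= i < b)%N -> m j <= m i) -> m j * (d b - d a) ^+ 2 <= T.
  move=> ab bK jK mj.
  have zab : z b - z a <= 1.
    by apply: le_trans zle; rewrite lerB// zmono// (leq_trans ab).
  apply: (@le_trans _ _ (\sum_(a <= i < b)
      m i * ((d i.+1 - d i) ^+ 2 / (z i.+1 - z i)))).
    have /(ler_wpM2l (m0 _ jK))/le_trans : (d b - d a) ^+ 2 <=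
        \sum_(a <= i < b) (d i.+1 - d i) ^+ 2 / (z i.+1 - z i).
      apply: sqr_increment_le => // i /andP[_ ib].
      by rewrite zlt// (leq_trans ib).
    apply.
    rewrite mulr_sumr big_nat_cond [leRHS]big_nat_cond.
    apply: ler_sum => i; rewrite andbT => iab; apply: ler_wpM2r; last exact: mj.
    by case/andP: iab => _ ib; rewrite e0// (leq_trans ib).
  rewrite /T (big_cat_nat (n := b) (leq0n _) bK)/=.
  rewrite (big_cat_nat (n := a) (leq0n _) ab)/= addrAC lerDr addr_ge0//.
    rewrite big_nat_cond sumr_ge0// => i; rewrite andbT => /andP[_ ia].
    have iK : (i < K)%N by rewrite (leq_trans ia)// (leq_trans ab).
    by rewrite mulr_ge0// ?m0// e0.
  rewrite big_nat_cond sumr_ge0// => i; rewrite andbT => /andP[_ iK].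
  by rewrite mulr_ge0// ?m0// e0.
have mdT j : (j < K)%N -> m j * d j ^+ 2 <= T.
  move=> jK; have [mj|mj] := mqc _ jK.
    have := @part j K j (ltnW jK) (leqnn _) jK mj.
    by rewrite dK sub0r sqrrN.
  have := @part 0 j j (leq0n _) (ltnW jK) jK.
  rewrite d0 subr0; apply=> i /andP[_ ij]; exact/mj/ltnW.
have T0 : 0 <= T.
  rewrite /T big_nat_cond sumr_ge0// => i; rewrite andbT => /andP[_ iK].
  by rewrite mulr_ge0// ?m0// e0.
apply: (@le_trans _ _ (\sum_(0 <= i < K) T * (z i.+1 - z i))).
  rewrite big_nat_cond [leRHS]big_nat_cond.
  apply: ler_sum => i; rewrite andbT => /andP[_ iK].
  rewrite mulrAC ler_wpM2r// ?mdT// subr_ge0 ltW// zlt//.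
by rewrite -mulr_sumr telescope_sumr// ler_piMr.
Qed.

(** * Convex functions on the unit interval *)

Definition convex01 (R : realFieldType) (H : R -> R) := forall x y s : R,
  0 <= x <= 1 -> 0 <= y <= 1 -> 0 <= s <= 1 ->
  H (s * x + (1 - s) * y) <= s * H x + (1 - s) * H y.

Section convex01.
Context {R : realFieldType} (H : R -> R) (cH : convex01 H).

(** The chord inequality with denominators cleared, so that coinciding points are allowed. *)
Lemma convex01_3pts u v w : 0 <= u -> u <= v -> v <= w -> w <= 1 ->
  H v * (w - u) <= (w - v) * H u + (v - u) * H w.
Proof.
move=> u0 uv vw w1.
have [uw|wu] := ltP u w; last first.
  have -> : v = u by lra.
  have -> : w = u by lra.
  lra.
have wu0 : 0 < w - u by lra.
have s01 : 0 <= (w - v) / (w - u) <= 1.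
  by rewrite divr_ge0 ?ler_pdivrMr//; lra.
have := @cH u w _ ltac:(lra) ltac:(lra) s01.
have -> : (w - v) / (w - u) * u + (1 - (w - v) / (w - u)) * w = v by field; lra.
have -> : (w - v) / (w - u) * H u + (1 - (w - v) / (w - u)) * H w =
    ((w - v) * H u + (v - u) * H w) / (w - u) by field; lra.
by rewrite ler_pdivlMr.
Qed.

(** With [convex01_nincr], this supplies the dichotomy on [m] in [discrete_poincare]: a step up
    bounds the later values from below, a step down the earlier ones. *)
Lemma convex01_ndecr u v w : 0 <= u -> u < v -> v <= w -> w <= 1 ->
  H u <= H v -> H u <= H w.
Proof.
move=> u0 uv vw w1 Huv.
have := convex01_3pts u0 (ltW uv) vw w1; nra.
Qed.

Lemma convex01_nincr u v w : 0 <= u -> u <= v -> v < w -> w <= 1 ->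
  H w < H v -> H v <= H u.
Proof.
move=> u0 uv vw w1 Hvw.
have := convex01_3pts u0 uv (ltW vw) w1; nra.
Qed.

(** The increment from [u] to [v] continues at least as steeply from [v] to the endpoint of the unit
    interval beyond it, along a chord of length at least [e] and rise at most [M]. *)
Lemma convex01_lipschitz M e u v : (forall x : R, 0 <= x <= 1 -> 0 <= H x <= M) ->
  0 < e -> e <= u <= 1 - e -> e <= v <= 1 - e ->
  H v - H u <= M / e * `|v - u|.
Proof.
move=> HM e0 /andP[eu ue] /andP[ev ve].
have /andP[H00 H0M] : 0 <= H 0 <= M by apply: HM; lra.
have /andP[H10 H1M] : 0 <= H 1 <= M by apply: HM; lra.
have /andP[Hu0 HuM] : 0 <= H u <= M by apply: HM; lra.
have /andP[Hv0 HvM] : 0 <= H v <= M by apply: HM; lra.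
rewrite mulrAC ler_pdivlMr//.
have [uv|vu] := leP u v.
  rewrite ger0_norm; last lra.
  have h := @convex01_3pts u v 1 ltac:(lra) uv ltac:(lra) (lexx _).
  have h2 : (H v - H u) * (1 - v) <= M * (v - u) by nra.
  have [|] := leP (H v) (H u); nra.
rewrite ltr0_norm; last lra.
have h := @convex01_3pts 0 v u (lexx _) ltac:(lra) ltac:(lra) ltac:(lra).
have h2 : (H v - H u) * v <= M * (u - v) by nra.
have [|] := leP (H v) (H u); nra.
Qed.

End convex01.

(** * The one-dimensional inequality *)

Lemma itv_lipschitz_continuous (R : realType) (al be N : R) (A : R -> R) :
  (forall u v, al <= u -> u <= v -> v <= be -> 0 <= A v - A u <= N * (v - u)) ->
  {within `[al, be], continuous A}.
Proof.
move=> hA; apply/subspace_continuousP => x; rewrite /= in_itv/= => /andP[ax xb].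
apply/cvgrPdist_lt => e e0.
have N0 : 0 < `|N| + 1 by rewrite ltr_wpDl.
rewrite near_withinE; near=> y; rewrite /= in_itv/= => /andP[ay yb].
have : `|A x - A y| <= `|N| * `|x - y|.
  have [xy|/ltW yx] := leP x y.
    have /andP[h1 h2] := hA _ _ ax xy yb.
    rewrite distrC ger0_norm// (le_trans h2)// (distrC x) -normrM.
    exact: ler_norm.
  have /andP[h1 h2] := hA _ _ ay yx xb.
  by rewrite ger0_norm// (le_trans h2)// -normrM; exact: ler_norm.
move=> /le_lt_trans; apply.
apply: (@le_lt_trans _ _ ((`|N| + 1) * `|x - y|)).
  by rewrite ler_wpM2r// lerDl.
rewrite mulrC -ltr_pdivlMr//.
by near: y; apply: cvgr_dist_lt => //; exact: divr_gt0.
Unshelve. all: by end_near. Qed.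

(** The intermediate value theorem gives points of prescribed value; the lower slope [eps] makes [A]
    injective, which pins the first and last points to [al] and [be]. *)
Lemma equipartition (R : realType) (al be eps N : R) (A : R -> R) (K : nat) :
  al < be -> 0 < eps -> (0 < K)%N ->
  (forall u v, al <= u -> u <= v -> v <= be ->
    eps * (v - u) <= A v - A u <= N * (v - u)) ->
  exists x : nat -> R, [/\ x 0 = al, x K = be
    & forall j, (j < K)%N -> [/\ al <= x j, x j < x j.+1, x j.+1 <= be &
        A (x j.+1) - A (x j) = (A be - A al) / K%:R]].
Proof.
move=> ab eps0 K0 hA.
have K0' : 0 < K%:R :> R by rewrite ltr0n.
have hA0 u v : al <= u -> u <= v -> v <= be -> 0 <= A v - A u <= N * (v - u).
  move=> au uv vb; have /andP[h ->] := hA u v au uv vb.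
  by rewrite andbT (le_trans _ h)// mulr_ge0 ?subr_ge0// ltW.
have Aab : A al <= A be.
  by have := hA0 _ _ (lexx _) (ltW ab) (lexx _); rewrite subr_ge0 => /andP[].
have Ainj u v : al <= u <= be -> al <= v <= be -> A u <= A v -> u <= v.
  move=> /andP[au ub] /andP[av vb] uv; rewrite leNgt; apply/negP => vu.
  have /andP[h _] := hA _ _ av (ltW vu) ub.
  have : 0 < eps * (u - v) by rewrite mulr_gt0// subr_gt0.
  lra.
(* [minn j K] keeps the target between [A al] and [A be] for every natural [j], so that one choice
   function covers all indices. *)
have /(_ _)/cid2-/all_sig2[x xab xA] (j : nat) : exists2 c, c \in `[al, be] &
    A c = A al + (A be - A al) * (minn j K)%:R / K%:R.
  apply: IVT; [exact: ltW|exact: itv_lipschitz_continuous hA0|].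
  have r0 : 0 <= (minn j K)%:R / K%:R :> R by rewrite divr_ge0.
  have r1 : (minn j K)%:R / K%:R <= 1 :> R.
    by rewrite ler_pdivrMr// mul1r ler_nat geq_minr.
  rewrite (min_idPl Aab) (max_idPr Aab) -mulrA.
  rewrite lerDl mulr_ge0 ?subr_ge0//= -lerBrDl ler_piMr ?subr_ge0//.
have {}xab j : al <= x j <= be by have := xab j; rewrite in_itv.
have ale : al <= al <= be by rewrite lexx ltW.
have bel : al <= be <= be by rewrite lexx ltW.
have xA0 : A (x 0) = A al by rewrite xA min0n mulr0 mul0r addr0.
have xAK : A (x K) = A be by rewrite xA minnn mulfK ?gt_eqF//; lra.
exists x; split => [||j jK].
- by apply/le_anti/andP; split; apply: Ainj => //; rewrite xA0.
- by apply/le_anti/andP; split; apply: Ainj => //; rewrite xAK.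
have dA : A (x j.+1) - A (x j) = (A be - A al) / K%:R.
  rewrite !xA (minn_idPl jK) (minn_idPl (ltnW jK))// -natr1.
  by field; rewrite gt_eqF.
have /andP[ax xb] := xab j; have /andP[ax' xb'] := xab j.+1.
split => //; rewrite ltNge; apply/negP => /(hA0 _ _ ax')/(_ xb)/andP[+ _].
have : 0 < A be - A al.
  have /andP[h _] := hA _ _ (lexx _) (ltW ab) (lexx _).
  by apply: lt_le_trans h; rewrite mulr_gt0// subr_gt0.
move=> /(divr_gt0)/(_ K0'); lra.
Qed.

(* [w (w - e)] is the product of two lengths with mean [w], so its square root is
   at most [w - e / 2]; [lam] and [p] absorb the errors of the discretization. *)
Lemma cell_bound (R : realFieldType) (q m lam p e w : R) :
  0 <= m -> 0 <= lam -> 0 <= p -> 0 <= e -> 0 < w -> 0 <= q -> e <= w ->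
  q ^+ 2 <= ((m + lam) * (1 + p)) ^+ 2 * (w * (w - e)) ->
  q <= m * w + m * w * p - m * e / 2 + lam * (1 + p) * w.
Proof.
move=> m0 l0 p0 e0 w0 q0 ew hq.
have s0 : 0 <= w - e / 2 by lra.
have Q0 : 0 <= (m + lam) * (1 + p) by rewrite mulr_ge0; lra.
apply: (@le_trans _ _ ((m + lam) * (1 + p) * (w - e / 2))).
  rewrite -(@ler_pXn2r _ 2) ?nnegrE//; last exact: mulr_ge0.
  apply: (le_trans hq); rewrite [leRHS]exprMn ler_wpM2l// ?sqr_ge0//.
  by have := sqr_ge0 e; lra.
have h1 : 0 <= (m + lam) * p * e by rewrite !mulr_ge0// addr_ge0.
have h2 : 0 <= lam * e by rewrite mulr_ge0.
lra.
Qed.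

(** One cell of the discrete transport: [q] is the geometric mean of the masses of [[x, x']] and
    [[y, y']], and [S] stands for the mass of [H] on [[z, z']]. Summed over the cells, the bound
    telescopes in [S] and leaves half the difference of the two sides of the Poincaré inequality,
    plus an error of order [h]. The divisor 8 turns [(2 * d) ^+ 2] into the gain [d ^+ 2 / 2], which
    matches the loss [m * e / 2] in [cell_bound]. *)
Lemma transport_cell (R : realFieldType) (H : R -> R)
    (x x' y y' q L M C0 h S : R) (z := (x + y) / 2) (z' := (x' + y') / 2)
    (d := (y - x) / 2) (d' := (y' - x') / 2) :
  0 <= x -> x < x' -> x' <= 1 -> 0 <= y -> y < y' -> y' <= 1 ->
  x' - x <= h -> y' - y <= h -> 0 <= h -> h <= C0 -> 0 <= L -> 0 <= q ->
  0 <= H z <= M ->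
  (forall r, z <= r <= z' -> 0 <= H r /\ H z - L * h <= H r <= H z + L * h) ->
  (forall C, 0 <= C -> (forall s t, x <= s <= x' -> y <= t <= y' ->
     H ((s + t) / 2) * (1 + (s - t) ^+ 2 / 8) <= C) ->
   q ^+ 2 <= C ^+ 2 * ((x' - x) * (y' - y))) ->
  (forall m, (forall r, z <= r <= z' -> m <= H r) -> m * (z' - z) <= S) ->
  q <= S + (H z * (z' - z) * d ^+ 2 - H z * ((d' - d) ^+ 2 / (z' - z))) / 2 +
    h * (M * (1 + C0) + L * (2 + (1 + C0) * C0) + L) * (z' - z).
Proof.
move=> x0 xx x1 y0 yy y1 xh yh h0 hC L0 q0 /andP[m0 mM] Lip hAB hS.
have w0 : 0 < z' - z by rewrite /z /z'; lra.
have d1 : -1/2 <= d <= 1/2 by rewrite /d; lra.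
have dd : d ^+ 2 <= 1 by move: (d) d1 => D; clear; nra.
set c1 := 1 + C0; have c10 : 0 <= c1 by rewrite /c1; lra.
have hc : 0 <= c1 * h by rewrite mulr_ge0.
(* On the cell, [s - t] is within [h] of [- (2 * d)], so [(s - t) ^+ 2 / 8] exceeds [d ^+ 2 / 2] by
   an error that [h <= C0] makes linear in [h]. *)
pose p := d ^+ 2 / 2 + c1 * h.
have p0 : 0 <= p by rewrite addr_ge0// divr_ge0// sqr_ge0.
have Lh0 : 0 <= L * h by rewrite mulr_ge0.
have Sz : H z * (z' - z) <= S + L * h * (z' - z).
  have := hS (H z - L * h); rewrite mulrBl lerBlDr; apply=> r zr.
  by have [_ /andP[]] := Lip r zr.
pose e := (d' - d) ^+ 2 / (z' - z).
(* Discrete form of [dx dy = dz^2 - dd^2]. *)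
have wE : (z' - z) * (z' - z - e) = (x' - x) * (y' - y).
  by rewrite /e mulrBr [X in _ - X]mulrC divfK ?gt_eqF// /d /d' /z /z'; field.
have e0 : 0 <= e by rewrite divr_ge0 ?sqr_ge0// ltW.
have ew : e <= z' - z.
  rewrite -subr_ge0 -(pmulr_rge0 _ w0) wE.
  by apply: mulr_ge0; rewrite subr_ge0; exact: ltW.
have qC : q ^+ 2 <= ((H z + L * h) * (1 + p)) ^+ 2 * ((z' - z) * (z' - z - e)).
  rewrite wE; apply: hAB; first exact: mulr_ge0 (addr_ge0 m0 Lh0) (addr_ge0 ler01 p0).
  move=> s t /andP[s1 s2] /andP[t1 t2].
  have [|Hr0 /andP[_ Hr]] := Lip ((s + t) / 2); first by rewrite /z /z'; lra.
  apply: ler_pM => //; first by rewrite addr_ge0// divr_ge0// sqr_ge0.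
  have : - (2 * d) - h <= s - t <= - (2 * d) + h by rewrite /d; lra.
  rewrite /p /c1; move: (s - t) (d) d1 => u D D1 uD.
  have -> : u = - (2 * D) + (u + 2 * D) by ring.
  have : - h <= u + 2 * D <= h by lra.
  move: (u + 2 * D) D1 h0 hC; clear=> r D1 h0 hC rh; nra.
have := cell_bound m0 Lh0 p0 e0 w0 q0 ew qC.
rewrite -/e => /le_trans; apply.
have Mc : H z * (c1 * h * (z' - z)) <= M * (c1 * h * (z' - z)).
  by rewrite ler_wpM2r// mulr_ge0// ltW.
(* The factor [h] is already present, so a constant bound on [p] suffices. *)
have pL : L * h * (z' - z) * p <= L * h * (z' - z) * (1 + c1 * C0).
  apply: ler_wpM2l; first by rewrite mulr_ge0// ltW.
  have : c1 * h <= c1 * C0 by rewrite ler_wpM2l.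
  rewrite /p; lra.
move: (z' - z) pL Mc Sz; rewrite /p; clear; move=> w; lra.
Qed.

(* [A], [B] and [S] stand for primitives of [F], [G] and [H], and the hypothesis
   on products of increments of [A] and [B] for the integrated form of
   [F s * G t <= (H ((s + t) / 2) * (1 + (s - t)^2 / 8))^2]. *)
Lemma transport_core (R : realType) (al be eps N M L : R) (A B S H : R -> R) :
  0 <= al -> al < be -> be <= 1 -> 0 < eps -> 0 <= L ->
  (forall u v, al <= u -> u <= v -> v <= be ->
    eps * (v - u) <= A v - A u <= N * (v - u)) ->
  (forall u v, al <= u -> u <= v -> v <= be ->
    eps * (v - u) <= B v - B u <= N * (v - u)) ->
  (forall u v m, al <= u -> u <= v -> v <= be ->
    (forall r, u <= r <= v -> m <= H r) -> m * (v - u) <= S v - S u) ->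
  (forall x x' y y' C : R, al <= x -> x <= x' -> x' <= be ->
    al <= y -> y <= y' -> y' <= be -> 0 <= C ->
    (forall s t, x <= s <= x' -> y <= t <= y' ->
      H ((s + t) / 2) * (1 + (s - t) ^+ 2 / 8) <= C) ->
    (A x' - A x) * (B y' - B y) <= C ^+ 2 * ((x' - x) * (y' - y))) ->
  convex01 H -> (forall x : R, 0 <= x <= 1 -> 0 <= H x <= M) ->
  (forall u v, al <= u <= be -> al <= v <= be ->
    H v - H u <= L * `|v - u|) ->
  (A be - A al) * (B be - B al) <= (S be - S al) ^+ 2.
Proof.
move=> al0 ab be1 eps0 L0 hA hB hS hAB cH HM HL.
have a0 : 0 < A be - A al.
  have /andP[h _] := hA _ _ (lexx _) (ltW ab) (lexx _).
  by apply: lt_le_trans h; rewrite mulr_gt0// subr_gt0.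
have b0 : 0 < B be - B al.
  have /andP[h _] := hB _ _ (lexx _) (ltW ab) (lexx _).
  by apply: lt_le_trans h; rewrite mulr_gt0// subr_gt0.
set a := A be - A al in a0 *; set b := B be - B al in b0 *.
(* With both masses cut into [K] equal parts, [g / K] is the geometric mean of the masses of two
   matching cells. *)
pose g := Num.sqrt (a * b).
have g0 : 0 <= g by exact: sqrtr_ge0.
have gE : g ^+ 2 = a * b by rewrite sqr_sqrtr// ltW// mulr_gt0.
have /andP[H00 H0M] : 0 <= H 0 <= M by apply: HM; lra.
have M0 : 0 <= M by exact: le_trans H0M.
(* A slope of at least [eps] makes a cell of mass at most [(a + b) / K] no wider than [C0 / K]; [C2]
   collects the error constants of [transport_cell]. *)
pose C0 := (a + b) / eps.
have C00 : 0 <= C0 by apply: divr_ge0; [apply: addr_ge0|]; exact: ltW.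
pose c1 := 1 + C0; pose C2 := M * c1 + L * (2 + c1 * C0) + L.
have C20 : 0 <= C2.
  have c10 : 0 <= c1 by rewrite addr_ge0.
  by rewrite !addr_ge0// mulr_ge0// addr_ge0// mulr_ge0.
(* The discretization error is of order [1 / K] and disappears as [K] grows. *)
suff main (K : nat) : (0 < K)%N -> g <= S be - S al + C2 * C0 / K%:R.
  have gS : g <= S be - S al.
    apply/ler_addgt0Pr => e e0.
    have [k hk] := @ltr_add_invr R 0 (e / (C2 * C0 + 1))
      ltac:(by rewrite divr_gt0// ltr_wpDl// mulr_ge0).
    apply: (le_trans (main k.+1 _)) => //; rewrite lerD2l.
    rewrite add0r in hk.
    apply: (@le_trans _ _ ((C2 * C0 + 1) * (e / (C2 * C0 + 1)))).
      by apply: ler_pM; [exact: mulr_ge0|rewrite invr_ge0|rewrite lerDl|exact: ltW].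
    by rewrite mulrC divfK// gt_eqF// ltr_wpDl// mulr_ge0.
  by rewrite -gE ler_pXn2r ?nnegrE// (le_trans g0).
move=> K0.
have K0' : 0 < K%:R :> R by rewrite ltr0n.
have K1 : 1 <= K%:R :> R by rewrite ler1n.
have [x [x0 xK hx]] := equipartition ab eps0 K0 hA.
have [y [y0 yK hy]] := equipartition ab eps0 K0 hB.
pose h := C0 / K%:R.
have h0 : 0 <= h by rewrite divr_ge0// ltW.
have hC : h <= C0 by rewrite ler_pdivrMr// ler_peMr.
have mesh (D : R -> R) (X : nat -> R) (c : R) j : 0 <= c -> c <= a + b ->
    (forall u v, al <= u -> u <= v -> v <= be ->
      eps * (v - u) <= D v - D u <= N * (v - u)) ->
    [/\ al <= X j, X j < X j.+1, X j.+1 <= be & D (X j.+1) - D (X j) = c / K%:R] ->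
    X j.+1 - X j <= h.
  move=> c0 cab hD [al1 X1 be2 DX].
  have /andP[+ _] := hD _ _ al1 (ltW X1) be2; rewrite DX => le1.
  rewrite /h /C0 mulrAC ler_pdivlMr// mulrC (le_trans le1)//.
  by rewrite ler_wpM2r// invr_ge0 ltW.
pose z j := (x j + y j) / 2; pose d j := (y j - x j) / 2; pose m j := H (z j).
have zlt j : (j < K)%N -> z j < z j.+1.
  by move=> jK; have [_ ? _ _] := hx _ jK; have [_ ? _ _] := hy _ jK; rewrite /z; lra.
have z01 j : (j <= K)%N -> al <= z j <= be.
  rewrite leq_eqVlt => /predU1P[->|jK]; first by rewrite /z xK yK; lra.
  by have [? ? ? _] := hx _ jK; have [? ? ? _] := hy _ jK; rewrite /z; lra.
have m0 j : (j <= K)%N -> 0 <= m j <= M.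
  by move=> /z01 zj; apply: HM; lra.
have zKE : z K - z 0 = be - al by rewrite /z x0 xK y0 yK; lra.
have zmono i j : (i <= j)%N -> (j <= K)%N -> z i <= z j.
  move=> ij jK; rewrite -subr_ge0 -telescope_sumr// big_nat_cond.
  apply: sumr_ge0 => k; rewrite andbT => /andP[_ kj].
  by rewrite subr_ge0 ltW// zlt// (leq_trans kj).
have cell j : (j < K)%N -> g / K%:R <= (S (z j.+1) - S (z j)) +
    (m j * (z j.+1 - z j) * d j ^+ 2 -
     m j * ((d j.+1 - d j) ^+ 2 / (z j.+1 - z j))) / 2 +
    h * C2 * (z j.+1 - z j).
  move=> jK.
  have hxj := hx _ jK; have hyj := hy _ jK.
  have xh := mesh A x a j (ltW a0) ltac:(by rewrite lerDl ltW) hA hxj.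
  have yh := mesh B y b j (ltW b0) ltac:(by rewrite lerDr ltW) hB hyj.
  case: hxj => ax xx xb xA; case: hyj => ay yy yb yB.
  have /andP[az zb] := z01 _ (ltnW jK); have /andP[az' zb'] := z01 _ jK.
  have zh : z j.+1 - z j <= h by rewrite /z; lra.
  apply: (transport_cell (H := H) _ xx _ _ yy _ xh yh h0 hC L0).
  - exact: le_trans ax.
  - exact: le_trans be1.
  - exact: le_trans ay.
  - exact: le_trans be1.
  - by rewrite divr_ge0// ltW.
  - exact: m0 (ltnW jK).
  - move=> r /andP[r1 r2].
    have rab : al <= r <= be by rewrite (le_trans az)//= (le_trans r2).
    have zab : al <= z j <= be by rewrite az zb.
    split; first by have /andP[] : 0 <= H r <= M by apply: HM; lra.
    have n1 : L * `|r - z j| <= L * h.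
      by rewrite ler_wpM2l// ger0_norm ?subr_ge0//; rewrite /z in r2 zh *; lra.
    have e1 := HL _ _ rab zab; have e2 := HL _ _ zab rab.
    rewrite distrC in e1; rewrite -/(z j); move: e1 e2 n1; clear; lra.
  - move=> C C_ge0 hC'; rewrite expr_div_n gE.
    have := hAB _ _ _ _ C ax (ltW xx) xb ay (ltW yy) yb C_ge0 hC'.
    by rewrite xA yB mulrACA expr2 invfM.
  - by move=> m' hm'; apply: hS => //; exact/ltW/zlt.
have poin := @discrete_poincare _ K z d m zlt ltac:(by rewrite zKE; lra)
  ltac:(by rewrite /d x0 y0; lra) ltac:(by rewrite /d xK yK; lra)
  (fun i iK => proj1 (andP (m0 i (ltnW iK)))).
have {}poin : \sum_(0 <= i < K) m i * (z i.+1 - z i) * d i ^+ 2 <=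
  \sum_(0 <= i < K) m i * ((d i.+1 - d i) ^+ 2 / (z i.+1 - z i)).
  apply: poin => j jK; rewrite /m.
  have /andP[z1 z2] := z01 _ (ltnW jK); have /andP[z3 z4] := z01 _ jK.
  (* If [H] does not drop from [z j] to [z j.+1], convexity keeps it at least [H (z j)] further
     right; if it drops, further left. *)
  have [le|lt] := leP (H (z j)) (H (z j.+1)); [left|right].
    move=> i /andP[]; rewrite leq_eqVlt => /predU1P[->//|ji] iK.
    have /andP[z5 z6] := z01 _ (ltnW iK).
    apply: (convex01_ndecr cH _ (zlt _ jK)) => //; try lra.
    exact: (zmono _ _ ji (ltnW iK)).
  move=> i ij; have /andP[z5 z6] := z01 _ (leq_trans ij (ltnW jK)).
  apply: (@convex01_nincr _ _ cH _ _ (z j.+1)) => //; try lra.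
  - exact: (zmono _ _ ij (ltnW jK)).
  - exact: zlt.
(* The cell bounds are summed: the increments of [S] telescope, and the Poincaré inequality makes
   the middle sum nonpositive. *)
have -> : g = \sum_(0 <= j < K) g / K%:R.
  by rewrite sumr_const_nat subn0 -[RHS]mulr_natr divfK ?gt_eqF.
apply: (@le_trans _ _ (\sum_(0 <= j < K) ((S (z j.+1) - S (z j)) +
    (m j * (z j.+1 - z j) * d j ^+ 2 -
     m j * ((d j.+1 - d j) ^+ 2 / (z j.+1 - z j))) / 2 +
    h * C2 * (z j.+1 - z j)))).
  rewrite big_nat_cond [leRHS]big_nat_cond.
  by apply: ler_sum => j; rewrite andbT => /andP[_]; exact: cell.
rewrite 2!big_split/= (telescope_sumr (fun j => S (z j)))//.
rewrite -mulr_suml -mulr_sumr sumrB telescope_sumr// zKE.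
have zal : z 0 = al by rewrite /z x0 y0; lra.
have zbe : z K = be by rewrite /z xK yK; lra.
rewrite zal zbe -(mulrA C2) -/h.
have hC2 : 0 <= h * C2 by rewrite mulr_ge0.
have : h * C2 * (be - al) <= h * C2 by rewrite ler_piMr//; lra.
move: poin; lra.
Qed.

(** * Integrals of bounded functions over segments *)

Section itv_integral.
Context {R : realType}.
Notation leb := (@lebesgue_measure R).
Implicit Types (F G : R -> R) (u v w N C : R).

Lemma integrable_itv_cst u v C : leb.-integrable `[u, v] (EFin \o cst C).
Proof.
apply: continuous_compact_integrable; first exact: segment_compact.
by apply: continuous_subspaceT => x; exact: cvg_cst.
Qed.

Lemma bounded_integrable_itv F u v N : measurable_fun setT F ->
  (forall x, 0 <= F x <= N) -> leb.-integrable `[u, v] (EFin \o F).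
Proof.
move=> mF F0N; apply: (@le_integrable _ _ _ _ _ _ _ (EFin \o cst N)) => //=.
- by apply/measurable_EFinP; exact: measurable_funTS.
- move=> x _; have /andP[F0 FN] := F0N x.
  by rewrite lee_fin !ger0_norm// (le_trans F0).
- exact: integrable_itv_cst.
Qed.

Lemma Rintegral_itv_cst u v C : u <= v ->
  \int[leb]_(x in `[u, v]) (cst C x) = C * (v - u).
Proof.
move=> uv; rewrite Rintegral_cst//= lebesgue_measure_itv/= lte_fin.
by move: uv; rewrite le_eqVlt => /predU1P[->|->//]; rewrite ltxx subrr.
Qed.

Lemma Rintegral_itv_le F u v C : u <= v ->
  leb.-integrable `[u, v] (EFin \o F) -> (forall x, u <= x <= v -> F x <= C) ->
  \int[leb]_(x in `[u, v]) F x <= C * (v - u).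
Proof.
move=> uv iF FC; rewrite -Rintegral_itv_cst//.
by apply: le_Rintegral => //; exact: integrable_itv_cst.
Qed.

Lemma Rintegral_itv_ge F u v C : u <= v ->
  leb.-integrable `[u, v] (EFin \o F) -> (forall x, u <= x <= v -> C <= F x) ->
  C * (v - u) <= \int[leb]_(x in `[u, v]) F x.
Proof.
move=> uv iF FC; rewrite -Rintegral_itv_cst//.
by apply: le_Rintegral => //; exact: integrable_itv_cst.
Qed.

Lemma Rintegral_itv_split F u v w : u <= v -> v <= w ->
  leb.-integrable `[u, w] (EFin \o F) ->
  \int[leb]_(x in `[u, w]) F x - \int[leb]_(x in `[u, v]) F x =
  \int[leb]_(x in `[v, w]) F x.
Proof.
move=> uv vw iF; rewrite Rintegral_itvB ?bnd_simp//.
apply: Rintegral_itv_obnd_cbnd.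
by apply: integrableS iF => //; apply: subset_itv; rewrite bnd_simp.
Qed.

(** The product is integrated in one variable at a time, each over its own segment. *)
Lemma Rintegral_itv_mul_le F G x x' y y' C : x <= x' -> y <= y' ->
  leb.-integrable `[x, x'] (EFin \o F) -> leb.-integrable `[y, y'] (EFin \o G) ->
  (forall s t, x <= s <= x' -> y <= t <= y' -> F s * G t <= C) ->
  (\int[leb]_(s in `[x, x']) F s) * (\int[leb]_(t in `[y, y']) G t) <=
    C * ((x' - x) * (y' - y)).
Proof.
move=> xx yy iF iG FG; rewrite -RintegralZl// mulrA.
apply: Rintegral_itv_le => //.
  have : leb.-integrable `[y, y']
      (fun t => (\int[leb]_(s in `[x, x']) F s)%:E * (EFin \o G) t)%E.
    exact: integrableZl.
  exact.
move=> t yt; rewrite -RintegralZr//.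
apply: Rintegral_itv_le => //; last by move=> s xs; exact: FG.
have : leb.-integrable `[x, x'] (fun s => (EFin \o F) s * (G t)%:E)%E.
  exact: integrableZr.
exact.
Qed.

End itv_integral.

(** With [p = u ^+ 2], [exp (p / 9) <= 1 / (1 - p / 9) <= 1 + p / 8], where the last step amounts to
    [p * (1 - p) >= 0]. This pairs the constant 9 with the 8 of the transport bound. *)
Lemma expR_le_sqr (R : realType) (u : R) : -1 <= u <= 1 ->
  expR (2 / 9 * u ^+ 2) <= (1 + u ^+ 2 / 8) ^+ 2.
Proof.
move=> u1; have u2 : 0 <= u ^+ 2 <= 1 by rewrite sqr_ge0/=; nra.
have -> : 2 / 9 * u ^+ 2 = u ^+ 2 / 9 + u ^+ 2 / 9 by field.
rewrite expRD -expr2 ler_pXn2r ?nnegrE ?expR_ge0//; last lra.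
have := expR_ge1Dx (- (u ^+ 2 / 9)); rewrite expRN.
move: (u ^+ 2) u2 => p p01 h.
have e0 := expR_gt0 (p / 9); move: (expR _) h e0 => e h e0.
have {h} : (1 - p / 9) * e <= 1 by rewrite -ler_pdivlMr// div1r.
nra.
Qed.

(** [transport_core] is applied after a regularization: [F] and [G] are raised by [eps] so that
    their primitives have positive slope, [H] is raised by [e] to preserve the product hypothesis,
    and the interval is shrunk to [[eta, 1 - eta]], where the convex [H] is Lipschitz. The three
    parameters are then chosen small. *)
Lemma prekopa_unit_interval (R : realType) (N : R) (F G H : R -> R) :
  measurable_fun setT F -> measurable_fun setT G -> measurable_fun setT H ->
  (forall x, 0 <= F x <= N) -> (forall x, 0 <= G x <= N) ->
  (forall x, 0 <= H x <= N) -> convex01 H ->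
  (forall s t : R, 0 <= s <= 1 -> 0 <= t <= 1 ->
    F s * G t <= H ((s + t) / 2) ^+ 2 * expR (2 / 9 * (s - t) ^+ 2)) ->
  (\int[lebesgue_measure]_(x in `[0, 1]) F x) *
  (\int[lebesgue_measure]_(x in `[0, 1]) G x) <=
  (\int[lebesgue_measure]_(x in `[0, 1]) H x) ^+ 2.
Proof.
move=> mF mG mH F0N G0N H0N cH FGH.
pose I (D : R -> R) u v := \int[lebesgue_measure]_(x in `[u, v]) D x.
rewrite -/(I F 0 1) -/(I G 0 1) -/(I H 0 1).
have N0 : 0 <= N by have /andP[] := F0N 0; exact: le_trans.
have bint (D : R -> R) (u v : R) : measurable_fun setT D -> (forall x, 0 <= D x <= N) ->
    lebesgue_measure.-integrable `[u, v] (EFin \o D).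
  exact: bounded_integrable_itv.
pose sh (e : R) (D : R -> R) := fun x => D x + e.
have msh (e : R) (D : R -> R) : measurable_fun setT D -> measurable_fun setT (sh e D).
  by move=> mD; exact: measurable_funD.
have shN (e : R) (D : R -> R) : 0 <= e -> (forall x, 0 <= D x <= N) ->
    forall x, 0 <= sh e D x <= N + e.
  by move=> e0 DN x; have := DN x; rewrite /sh; lra.
have bsh (e : R) (D : R -> R) (u v : R) : 0 <= e -> measurable_fun setT D -> (forall x, 0 <= D x <= N) ->
    lebesgue_measure.-integrable `[u, v] (EFin \o sh e D).
  by move=> e0 mD DN; apply: bounded_integrable_itv (msh _ _ mD) (shN _ _ e0 DN).
have Ish (e : R) (D : R -> R) (u v : R) : measurable_fun setT D -> (forall x, 0 <= D x <= N) -> u <= v ->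
    I (sh e D) u v = I D u v + e * (v - u).
  move=> mD DN uv; rewrite /I RintegralD//; last 2 first.
    exact: bint.
    exact: integrable_itv_cst.
  by rewrite (Rintegral_itv_cst e uv).
have I01 (D : R -> R) : measurable_fun setT D -> (forall x, 0 <= D x <= N) -> 0 <= I D 0 1 <= N.
  move=> mD DN; rewrite Rintegral_ge0/=; last by move=> x _; case/andP: (DN x).
  have -> : N = N * (1 - 0) by rewrite subr0 mulr1.
  apply: Rintegral_itv_le => //; first exact: bint.
  by move=> x _; case/andP: (DN x).
have split3 (D : R -> R) (eta : R) : 0 < eta -> eta < 1 / 2 -> measurable_fun setT D ->
    (forall x, 0 <= D x <= N) ->
    I D eta (1 - eta) <= I D 0 1 <= I D eta (1 - eta) + 2 * eta * N.
  move=> e0 e2 mD DN.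
  have h1 := @Rintegral_itv_split _ D 0 eta 1 (ltW e0) ltac:(lra) (bint _ _ _ mD DN).
  have h2 := @Rintegral_itv_split _ D eta (1 - eta) 1 ltac:(lra) ltac:(lra)
    (bint _ _ _ mD DN).
  have D0 u v : 0 <= I D u v.
    by apply: Rintegral_ge0 => x _; case/andP: (DN x).
  have h3 : I D 0 eta <= N * (eta - 0).
    apply: Rintegral_itv_le; [exact: ltW|exact: bint|move=> x _].
    by case/andP: (DN x).
  have h4 : I D (1 - eta) 1 <= N * (1 - (1 - eta)).
    apply: Rintegral_itv_le; [lra|exact: bint|move=> x _].
    by case/andP: (DN x).
  have h5 := D0 0 eta; have h6 := D0 (1 - eta) 1.
  move: h1 h2 h3 h4 h5 h6; rewrite -!/(I _ _ _); lra.
(* The extra terms of [(F + eps) * (G + eps)] are at most [2 * N * eps + eps ^+ 2], while raising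
   [H] by [e] adds at least [e ^+ 2] to its square. *)
have inner (e eps eta : R) : 0 < e -> 0 < eps -> 2 * N * eps + eps ^+ 2 <= e ^+ 2 ->
    0 < eta -> eta < 1 / 2 ->
    I F eta (1 - eta) * I G eta (1 - eta) <= (I H 0 1 + e) ^+ 2.
  move=> e0 eps0 epse eta0 eta2.
  have core : (I (sh eps F) 0 (1 - eta) - I (sh eps F) 0 eta) *
      (I (sh eps G) 0 (1 - eta) - I (sh eps G) 0 eta) <=
      (I (sh e H) 0 (1 - eta) - I (sh e H) 0 eta) ^+ 2.
    have incr (c : R) (D : R -> R) (u v : R) : 0 <= c -> measurable_fun setT D -> (forall x, 0 <= D x <= N) ->
        0 <= u -> u <= v ->
        I (sh c D) 0 v - I (sh c D) 0 u = I (sh c D) u v.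
      by move=> c0 mD DN u0 uv; apply: Rintegral_itv_split => //; exact: bsh.
    have bounds (D : R -> R) : measurable_fun setT D -> (forall x, 0 <= D x <= N) ->
        forall u v, eta <= u -> u <= v -> v <= 1 - eta ->
        eps * (v - u) <= I (sh eps D) 0 v - I (sh eps D) 0 u <= (N + eps) * (v - u).
      move=> mD DN u v eu uv ve; rewrite incr//; [|exact: ltW|lra].
      apply/andP; split.
        apply: Rintegral_itv_ge => //; first exact: bsh (ltW _) _ _.
        by move=> x _; have := DN x; rewrite /sh; lra.
      apply: Rintegral_itv_le => //; first exact: bsh (ltW _) _ _.
      by move=> x _; have := DN x; rewrite /sh; lra.
    apply: (@transport_core _ eta (1 - eta) eps (N + eps) (N + e) (N / eta)
      (I (sh eps F) 0) (I (sh eps G) 0) (I (sh e H) 0) (sh e H)).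
    - exact: ltW.
    - lra.
    - lra.
    - exact: eps0.
    - by rewrite divr_ge0// ltW.
    - exact: bounds.
    - exact: bounds.
    - move=> u v m eu uv ve mH'; rewrite incr//; [|exact: ltW|lra].
      by apply: Rintegral_itv_ge => //; exact: bsh (ltW _) _ _.
    - move=> x x' y y' C ex xx x'e ey yy y'e C0 hC.
      rewrite !incr//; try exact: ltW; try lra.
      apply: Rintegral_itv_mul_le => //; try exact: bsh (ltW _) _ _.
      move=> s t xs yt; have := hC s t xs yt.
      have s01 : 0 <= s <= 1 by lra.
      have t01 : 0 <= t <= 1 by lra.
      have st : -1 <= s - t <= 1 by lra.
      have := expR_le_sqr st; have := FGH s t s01 t01; rewrite /sh.
      have /andP[_] := F0N s; have /andP[_] := G0N t.
      have /andP[] := H0N ((s + t) / 2).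
      have P1 : 1 <= 1 + (s - t) ^+ 2 / 8 by have := sqr_ge0 (s - t); lra.
      move: (H _) (F s) (G t) (expR _) (1 + _) P1 => h f g E P P1 h0 hN gN fN fgh EP hPC.
      apply: (@le_trans _ _ (((h + e) * P) ^+ 2)); last first.
        rewrite ler_pXn2r// ?nnegrE//; apply: mulr_ge0; [|exact: le_trans P1].
        by rewrite addr_ge0// ltW.
      apply: (@le_trans _ _ (h ^+ 2 * P ^+ 2 + e ^+ 2)).
        have : h ^+ 2 * E <= h ^+ 2 * P ^+ 2 by rewrite ler_wpM2l// sqr_ge0.
        have : (f + g) * eps <= 2 * N * eps by rewrite ler_wpM2r//; lra.
        move: fgh epse; rewrite (expr2 eps); lra.
      have P2 : 1 <= P ^+ 2 by rewrite exprn_ege1.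
      have : e ^+ 2 <= e ^+ 2 * P ^+ 2 by rewrite ler_peMr// sqr_ge0.
      have : 0 <= h * e * P ^+ 2 by rewrite mulr_ge0 ?sqr_ge0// mulr_ge0// ltW.
      by rewrite exprMn sqrrD mulrDl mulrDl mulrnAl mulr2n; lra.
    - move=> x y s x01 y01 s01; have := cH x y s x01 y01 s01; rewrite /sh; lra.
    - by move=> x _; exact: shN (ltW e0) _ _.
    - move=> u v eu ev; rewrite /sh opprD addrACA subrr addr0.
      by apply: (convex01_lipschitz cH) => // x _; exact: H0N.
  have incr (c : R) (D : R -> R) : 0 <= c -> measurable_fun setT D -> (forall x, 0 <= D x <= N) ->
      I (sh c D) 0 (1 - eta) - I (sh c D) 0 eta = I D eta (1 - eta) + c * (1 - eta - eta).
    move=> c0 mD DN; rewrite -Ish//; last lra.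
    by apply: Rintegral_itv_split; [lra|lra|exact: bsh].
  rewrite !incr// in core; try exact: ltW.
  have I0 (D : R -> R) : (forall x, 0 <= D x <= N) -> 0 <= I D eta (1 - eta).
    by move=> DN; apply: Rintegral_ge0 => x _; case/andP: (DN x).
  have le0 : 0 <= 1 - eta - eta by lra.
  apply: (@le_trans _ _ ((I H eta (1 - eta) + e * (1 - eta - eta)) ^+ 2)).
    apply: le_trans core; apply: ler_pM; rewrite ?I0// lerDl mulr_ge0//; exact: ltW.
  have /andP[HH _] := split3 _ _ eta0 eta2 mH H0N.
  have h1 : 0 <= e * (1 - eta - eta) by rewrite mulr_ge0// ltW.
  have h2 : e * (1 - eta - eta) <= e by rewrite ler_piMr; lra.
  have HI := I0 _ H0N; have /andP[HI1 _] := I01 _ mH H0N.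
  by rewrite ler_pXn2r ?nnegrE//; lra.
apply/ler_addgt0Pr => e' e'0.
have /andP[h0 hN] := I01 _ mH H0N.
have /andP[a0 aN] := I01 _ mF F0N.
have /andP[b0 bN] := I01 _ mG G0N.
(* With [h] the integral of [H], the final error is [2 * h * e + e ^+ 2] plus a boundary loss
   [4 * eta * N ^+ 2 <= e], together at most [(2 * N + 2) * e <= e']. *)
pose e := Num.min 1 (e' / (2 * N + 2)).
have N2 : 0 < 2 * N + 2 by lra.
have e0 : 0 < e by rewrite lt_min ltr01 divr_gt0.
have e1 : e <= 1 by rewrite ge_min lexx.
have ee' : e * (2 * N + 2) <= e'.
  by rewrite -ler_pdivlMr// ge_min lexx orbT.
pose eps := Num.min 1 (e ^+ 2 / (2 * N + 1)).
have N1 : 0 < 2 * N + 1 by lra.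
have eps0 : 0 < eps by rewrite lt_min ltr01 divr_gt0// exprn_gt0.
have eps1 : eps <= 1 by rewrite ge_min lexx.
have epse : eps * (2 * N + 1) <= e ^+ 2.
  by rewrite -ler_pdivlMr// ge_min lexx orbT.
pose eta := Num.min (1 / 4) (e / (4 * (N + 1) ^+ 2)).
have N4 : 0 < 4 * (N + 1) ^+ 2 by rewrite mulr_gt0// exprn_gt0// ltr_wpDl.
have eta0 : 0 < eta by rewrite lt_min !divr_gt0.
have eta1 : eta < 1 / 2 by rewrite gt_min; apply/orP; left; lra.
have etae : eta * (4 * (N + 1) ^+ 2) <= e.
  by rewrite -ler_pdivlMr// ge_min lexx orbT.
have := inner e eps eta e0 eps0 ltac:(nra) eta0 eta1.
have /andP[_] := split3 _ _ eta0 eta1 mF F0N.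
have /andP[Fa _] := split3 _ _ eta0 eta1 mF F0N.
have /andP[_] := split3 _ _ eta0 eta1 mG G0N.
have F'0 : 0 <= I F eta (1 - eta).
  by apply: Rintegral_ge0 => x _; case/andP: (F0N x).
move: F'0 Fa h0 hN a0 aN b0 bN.
move: (I F 0 1) (I G 0 1) (I H 0 1) (I F eta _) (I G eta _) => a b h a' b'.
move=> a'0 a'a h0 hN a0 aN b0 bN hb ha hab.
have dN0 : 0 <= 2 * eta * N by rewrite mulr_ge0// mulr_ge0// ltW.
have s1 : a * b <= (a' + 2 * eta * N) * b by rewrite ler_wpM2r.
have s2 : a' * b <= a' * (b' + 2 * eta * N) by rewrite ler_wpM2l.
have s3 : 2 * eta * N * b <= 2 * eta * N * N by rewrite ler_wpM2l.
have s4 : 2 * eta * N * a' <= 2 * eta * N * N.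
  by rewrite ler_wpM2l// (le_trans a'a).
have s5 : 4 * eta * N * N <= e.
  apply: le_trans etae; have := mulr_ge0 (ltW eta0) N0; rewrite expr2; lra.
have s6 : h * e <= N * e by rewrite ler_wpM2r// ltW.
have s7 : e * e <= e by rewrite ler_piMr// ltW.
move: hab; rewrite sqrrD (expr2 e) mulr2n; lra.
Qed.

(** * Slicing the cube *)

Section lebesgue_rV_sigma_finite.
Variable R : realType.

Lemma lebesgue_rV_sigma_finite n :
  sigma_finite [set: borel_rV R n] (@lebesgue_rV R n).
Proof.
exists (fun k => [set v : 'rV[R]_n | forall i, `[- k%:R, k%:R]%classic (v 0 i)]).
  apply/esym; rewrite -subTset => v _.
  exists (\max_(i < n) Num.bound `|(v : 'rV[R]_n) 0 i|%R) => //= i.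
  rewrite in_itv/= -ler_norml ltW//.
  apply: (lt_le_trans (archi_boundP (normr_ge0 _))).
  by rewrite ler_nat (leq_bigmax i).
move=> k; split.
  apply: (@measurable_preimage_box _ _ _ n id (fun=> `[- k%:R, k%:R]%classic)) => i.
    exact: measurable_fun_coord.
  exact: measurable_itv.
rewrite [ltLHS](@lebesgue_rV_box R n (fun=> `[- k%:R, k%:R]%classic)); last first.
  by move=> i; exact: measurable_itv.
rewrite ltey_eq; apply/orP; left.
apply: (big_ind (fun x : \bar R => x \is a fin_num)) => //.
  by move=> x y; exact: fin_numM.
move=> i _; rewrite lebesgue_measure_itv/= lte_fin.
by case: ifPn.
Qed.

HB.instance Definition _ n := Measure_isSigmaFinite.Build _ _ _
  (@lebesgue_rV R n) (@lebesgue_rV_sigma_finite n).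

(** Unfolds the recursive definition of the measure: a change of variables along [cons_rV], then
    Tonelli with the head coordinate outermost. *)
Lemma lebesgue_rV_tonelli n (g : borel_rV R n.+1 -> \bar R) :
  measurable_fun setT g -> (forall x, 0 <= g x)%E ->
  (\int[@lebesgue_rV R n.+1]_x g x =
   \int[lebesgue_measure]_s \int[@lebesgue_rV R n]_x g (cons_rV (x, s)))%E.
Proof.
move=> mg g0.
transitivity (\int[@lebesgue_rV R n \x lebesgue_measure]_p g (cons_rV p))%E.
  rewrite [LHS](ge0_integral_pushforward (@measurable_cons_rV R n)
    (@lebesgue_rV R n \x lebesgue_measure)%E measurableT mg)//.
rewrite fubini_tonelli2//.
exact: measurableT_comp mg (@measurable_cons_rV R n).
Qed.

Lemma measurable_fun_slice n (g : borel_rV R n.+1 -> \bar R) :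
  measurable_fun setT g -> (forall x, 0 <= g x)%E ->
  measurable_fun setT
    (fun s : measurableTypeR R => \int[@lebesgue_rV R n]_x g (cons_rV (x, s)))%E.
Proof.
move=> mg g0.
apply: (measurable_fun_fubini_tonelli_G (fun p => g (cons_rV p))) => //.
exact: measurableT_comp mg (@measurable_cons_rV R n).
Qed.

End lebesgue_rV_sigma_finite.

Definition cube (R : realType) n : set 'rV[R]_n :=
  [set u | forall i, 0 <= u 0 i <= 1].
Arguments cube : clear implicits.

Definition convex_on_cube (R : realType) n (H : 'rV[R]_n -> R) :=
  forall (x y : 'rV[R]_n) (s : R), cube R n x -> cube R n y -> 0 <= s <= 1 ->
    H (s *: x + (1 - s) *: y) <= s * H x + (1 - s) * H y.

(** Vanishing outside the cube turns integrals over the cube into integrals over the whole space;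
    the bound [N] makes them finite and passes to all slices. *)
Definition cube_fun (R : realType) n (N : R) (F : borel_rV R n -> R) :=
  [/\ measurable_fun setT F, forall x, 0 <= F x <= N
    & forall x, ~ cube R n x -> F x = 0].

Section cube_integral.
Variable R : realType.
Implicit Types (n : nat) (N c : R).

Lemma measurable_cube n : measurable (cube R n : set (borel_rV R n)).
Proof.
rewrite [X in measurable X](_ : _ = [set v : 'rV[R]_n |
    forall i, `[0, 1]%classic (v 0 i)]).
  apply: (@measurable_preimage_box _ _ _ n id (fun=> `[0, 1]%classic)) => i.
    exact: measurable_fun_coord.
  exact: measurable_itv.
by apply/seteqP; split => v /= vP i; have := vP i; rewrite in_itv.
Qed.

Lemma lebesgue_cube n : lebesgue_rV (cube R n) = 1%E.
Proof.
have -> : cube R n = [set v : 'rV[R]_n | forall i, `[0, 1]%classic (v 0 i)].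
  by apply/seteqP; split => v /= vP i; have := vP i; rewrite in_itv.
rewrite [LHS](@lebesgue_rV_box R n (fun=> `[0, 1]%classic)); last first.
  by move=> i; exact: measurable_itv.
rewrite big1// => i _.
by rewrite lebesgue_measure_itv/= lte_fin ltr01 oppr0 adde0.
Qed.

Definition cube_int n (F : borel_rV R n -> R) : R :=
  \int[@lebesgue_rV R n]_x F x.

Lemma cube_fun_ge0 n N F : @cube_fun R n N F -> 0 <= N.
Proof.
by case=> _ F0N _; have /andP[h0 hN] := F0N (0 : 'rV[R]_n);
exact: le_trans h0 hN.
Qed.

Lemma cube_fun_integral_le n N F : @cube_fun R n N F ->
  (\int[@lebesgue_rV R n]_x (F x)%:E <= N%:E)%E.
Proof.
move=> FN; have N0 := cube_fun_ge0 FN; case: FN => mF F0N F0.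
apply: (@le_trans _ _ (\int[@lebesgue_rV R n]_x (N * \1_(cube R n) x)%:E)%E).
  apply: ge0_le_integral => //=.
  - by move=> x _; rewrite lee_fin; case/andP: (F0N x).
  - exact/measurable_EFinP.
  - apply/measurable_EFinP; apply: measurable_funM => //.
    apply: measurable_indic; exact: measurable_cube.
  - move=> x _; rewrite lee_fin indicE; have [xc|xc] := boolP (x \in cube R n).
      by rewrite mulr1; case/andP: (F0N x).
    by rewrite mulr0 F0//; move/negP: xc; rewrite inE.
under eq_integral do rewrite EFinM.
rewrite ge0_integralZl//=.
- rewrite integral_indic//; last exact: measurable_cube.
  by rewrite setIT [X in (_ * X)%E](@lebesgue_cube n) mule1.
- apply/measurable_EFinP; apply: measurable_indic; exact: measurable_cube.
Qed.

(** [fine] sends infinite values to 0; the bound [N] excludes them. *)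
Lemma cube_intE n N F : @cube_fun R n N F ->
  ((cube_int F)%:E = \int[@lebesgue_rV R n]_x (F x)%:E)%E.
Proof.
move=> FN; rewrite /cube_int /Rintegral fineK// ge0_fin_numE.
  exact: le_lt_trans (cube_fun_integral_le FN) (ltry _).
by apply: integral_ge0 => x _; case: FN => _ F0N _; rewrite lee_fin; case/andP: (F0N x).
Qed.

Lemma cube_int_bounds n N F : @cube_fun R n N F -> 0 <= cube_int F <= N.
Proof.
move=> FN; rewrite -!lee_fin (cube_intE FN) cube_fun_integral_le// andbT.
by apply: integral_ge0 => x _; case: FN => _ F0N _; rewrite lee_fin; case/andP: (F0N x).
Qed.

Lemma cube_intZ n N F c : @cube_fun R n N F -> 0 <= c ->
  cube_int (fun x => c * F x) = c * cube_int F.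
Proof.
move=> FN c0; rewrite /cube_int /Rintegral.
under eq_integral do rewrite EFinM.
rewrite ge0_integralZl//=.
- by rewrite -(cube_intE FN).
- by case: FN => mF _ _; exact/measurable_EFinP.
- by move=> x _; case: FN => _ F0N _; rewrite lee_fin; case/andP: (F0N x).
Qed.

Lemma cube_funZ n N F c : @cube_fun R n N F -> 0 <= c ->
  cube_fun (c * N) (fun x => c * F x).
Proof.
move=> [mF F0N F0] c0; split.
- exact: measurable_funM.
- by move=> x; have /andP[h1 h2] := F0N x; rewrite mulr_ge0//= ler_wpM2l.
- by move=> x xc; rewrite F0// mulr0.
Qed.

Lemma cube_funW n N M F : @cube_fun R n N F -> N <= M -> cube_fun M F.
Proof.
move=> [mF F0N F0] NM; split=> // x.
by have /andP[-> /le_trans->] := F0N x.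
Qed.

Lemma cube_int_le2 n N F1 F2 F3 c1 c2 :
  @cube_fun R n N F1 -> @cube_fun R n N F2 -> @cube_fun R n N F3 ->
  0 <= c1 -> 0 <= c2 -> (forall x, F1 x <= c1 * F2 x + c2 * F3 x) ->
  cube_int F1 <= c1 * cube_int F2 + c2 * cube_int F3.
Proof.
move=> h1 h2 h3 c10 c20 F123.
have k2 := cube_funZ h2 c10; have k3 := cube_funZ h3 c20.
have pos M F : @cube_fun R n M F -> forall x, setT x -> (0 <= (F x)%:E)%E.
  by move=> [_ FN _] x _; rewrite lee_fin; case/andP: (FN x).
have meas M F : @cube_fun R n M F -> measurable_fun setT (EFin \o F).
  by move=> [? _ _]; exact/measurable_EFinP.
rewrite -(cube_intZ h2 c10) -(cube_intZ h3 c20).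
rewrite -lee_fin EFinD (cube_intE h1) (cube_intE k2) (cube_intE k3).
rewrite -ge0_integralD//; [|exact: pos k2|exact: meas k2|exact: pos k3|exact: meas k3].
apply: ge0_le_integral => //.
- exact: pos h1.
- exact: meas h1.
- by apply: emeasurable_funD; [exact: meas k2|exact: meas k3].
- by move=> x _; rewrite -EFinD lee_fin.
Qed.

Lemma cube_cons n (x : borel_rV R n) (s : R) :
  cube R n.+1 (cons_rV (x, s)) <-> cube R n x /\ 0 <= s <= 1.
Proof.
split=> [h|[hx hs] i].
  split=> [i|]; first by have := h (lift ord0 i); rewrite cons_rV_lift.
  by have := h ord0; rewrite cons_rV_ord0.
by have [j ->|->] := unliftP ord0 i; rewrite ?cons_rV_lift ?cons_rV_ord0.
Qed.

Lemma cons_rV_linear n (x y : borel_rV R n) (s t a b : R) :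
  a *: (cons_rV (x, s) : 'rV[R]_n.+1) + b *: (cons_rV (y, t) : 'rV[R]_n.+1) =
  cons_rV ((a *: (x : 'rV[R]_n) + b *: (y : 'rV[R]_n)) : borel_rV R n, a * s + b * t).
Proof.
have linE m (X Y : 'rV[R]_m) i : (a *: X + b *: Y) 0 i = a * X 0 i + b * Y 0 i.
  by rewrite !mxE.
apply/rowP => i; rewrite linE.
have [j ->|->] := unliftP ord0 i; last by rewrite !cons_rV_ord0.
by rewrite !cons_rV_lift linE.
Qed.

Definition slice n (F : borel_rV R n.+1 -> R) (s : R) : borel_rV R n -> R :=
  fun x => F (cons_rV (x, s)).

Lemma cube_fun_slice n N F s : @cube_fun R n.+1 N F -> cube_fun N (slice F s).
Proof.
move=> [mF F0N F0]; split=> [|x|x xc]; last 2 first.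
- exact: F0N.
- by apply: F0 => /cube_cons[].
exact: measurableT_comp mF (measurableT_comp (@measurable_cons_rV R n)
  (pair2_measurable s)).
Qed.

Lemma slice_int_out n N F s : @cube_fun R n.+1 N F -> ~ 0 <= s <= 1 ->
  cube_int (slice F s) = 0.
Proof.
move=> [_ _ F0] s01; rewrite /cube_int /Rintegral integral0_eq// => x _.
by rewrite /slice F0// => /cube_cons[].
Qed.

Lemma measurable_slice_int n N F : @cube_fun R n.+1 N F ->
  measurable_fun setT (fun s => cube_int (slice F s)).
Proof.
move=> [mF F0N _]; apply: measurableT_comp => //.
apply: (measurable_fun_slice (g := fun x => (F x)%:E)).
  exact/measurable_EFinP.
by move=> x; rewrite lee_fin; case/andP: (F0N x).
Qed.

Lemma cube_int_slice n N F : @cube_fun R n.+1 N F ->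
  cube_int F = \int[lebesgue_measure]_(s in `[0, 1]) cube_int (slice F s).
Proof.
move=> FN; rewrite {1}/cube_int /Rintegral lebesgue_rV_tonelli; last 2 first.
- by case: FN => mF _ _; exact/measurable_EFinP.
- by case: FN => _ F0N _ x; rewrite lee_fin; case/andP: (F0N x).
congr fine; rewrite [RHS]integral_mkcond; apply: eq_integral => s _.
rewrite -(cube_intE (cube_fun_slice s FN)) patchE.
case: ifPn => // /negP; rewrite inE/= in_itv/= => s01.
by rewrite (slice_int_out FN).
Qed.

(** Convexity along segments parallel to the head axis, integrated over the other coordinates. *)
Lemma convex_slice_int n N H : @cube_fun R n.+1 N H -> convex_on_cube H ->
  convex01 (fun s => cube_int (slice H s)).
Proof.
move=> HN cH s t a s01 t01 a01; have /andP[a0 a1] := a01.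
apply: cube_int_le2; [exact: cube_fun_slice HN|exact: cube_fun_slice HN|
  exact: cube_fun_slice HN|exact: a0|by rewrite subr_ge0|].
move=> x; have [xc|xc] := pselect (cube R n x); last first.
  have [_ _ H0] := HN.
  by rewrite /slice !H0 ?mulr0 ?addr0// => /cube_cons[].
have := cH (cons_rV (x, s)) (cons_rV (x, t)) a.
rewrite cons_rV_linear -scalerDl subrKC scale1r; apply => //; exact/cube_cons.
Qed.

Lemma convex_on_slice n H s : 0 <= s <= 1 -> @convex_on_cube R n.+1 H ->
  convex_on_cube (slice H s).
Proof.
move=> s01 cH x y a xc yc a01.
have := cH (cons_rV (x, s)) (cons_rV (y, s)) a.
rewrite cons_rV_linear -mulrDl subrKC mul1r; apply => //; exact/cube_cons.
Qed.

(** Induction on the dimension. The induction hypothesis compares the slices of [F] at [s], of [G]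
    at [t] and of [H] at [(s + t) / 2]; the resulting inequality between slice integrals is the
    hypothesis of [prekopa_unit_interval], whose convexity condition comes from
    [convex_slice_int]. *)
Lemma prekopa_cube n N (F G H : borel_rV R n -> R) :
  cube_fun N F -> cube_fun N G -> cube_fun N H -> convex_on_cube H ->
  (forall x y : 'rV[R]_n, cube R n x -> cube R n y ->
    F x * G y <= H (2^-1 *: x + 2^-1 *: y) ^+ 2 *
      expR (2 / 9 * \sum_(i < n) (x 0 i - y 0 i) ^+ 2)) ->
  cube_int F * cube_int G <= cube_int H ^+ 2.
Proof.
elim: n N F G H => [|n IH] N F G H FN GN HN cH FGH.
  have c0 : cube R 0 0 by move=> [].
  (* In dimension 0 the measure is the Dirac mass at the only point. *)
  have J0 (D : borel_rV R 0 -> R) : cube_fun N D -> cube_int D = D 0.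
    move=> [mD _ _]; rewrite /cube_int /Rintegral.
    have -> : (\int[@lebesgue_rV R 0]_x (D x)%:E)%E = (D (0 : 'rV[R]_0))%:E.
      rewrite [LHS](@integral_dirac _ (borel_rV R 0) (0 : 'rV[R]_0))//.
        by rewrite diracT mul1e.
      exact/measurable_EFinP.
    by [].
  rewrite !J0//; have := FGH 0 0 c0 c0.
  by rewrite big_ord0 mulr0 expR0 mulr1 !scaler0 addr0.
rewrite (cube_int_slice FN) (cube_int_slice GN) (cube_int_slice HN).
apply: (@prekopa_unit_interval R N); [exact: measurable_slice_int FN|
  exact: measurable_slice_int GN|exact: measurable_slice_int HN|
  by move=> s; exact: cube_int_bounds (cube_fun_slice s FN)|
  by move=> s; exact: cube_int_bounds (cube_fun_slice s GN)|
  by move=> s; exact: cube_int_bounds (cube_fun_slice s HN)|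
  exact: convex_slice_int HN cH|].
move=> s t s01 t01.
(* Square root of the exponential factor contributed by the head coordinate. It is constant on
   slices, so it is absorbed into the slice of [H], which raises the common bound from [N] to
   [c * N]. *)
pose c := expR (1 / 9 * (s - t) ^+ 2).
have c1 : 1 <= c by rewrite -expR0 ler_expR mulr_ge0// sqr_ge0.
have c0 : 0 <= c by exact: le_trans c1.
have N0 := cube_fun_ge0 FN.
have NcN : N <= c * N by rewrite ler_peMl.
have st01 : 0 <= (s + t) / 2 <= 1 by lra.
have cE : expR (2 / 9 * (s - t) ^+ 2) = c ^+ 2.
  by rewrite [RHS]expr2 -expRD; congr expR; field.
rewrite cE -exprMn (mulrC _ c) -(cube_intZ (cube_fun_slice _ HN) c0).
apply: (IH (c * N)).
- exact: cube_funW (cube_fun_slice _ FN) NcN.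
- exact: cube_funW (cube_fun_slice _ GN) NcN.
- exact: cube_funZ (cube_fun_slice _ HN) c0.
- move=> x y a xc yc a01; rewrite mulrCA (mulrCA _ c) -mulrDr ler_wpM2l//.
  exact: convex_on_slice.
move=> x y xc yc; rewrite /slice.
have := FGH (cons_rV (x, s)) (cons_rV (y, t)).
rewrite cons_rV_linear big_ord_recl !cons_rV_ord0/= mulrDr expRD cE.
under eq_bigr do rewrite !cons_rV_lift.
have -> : 2^-1 * s + 2^-1 * t = (s + t) / 2 by field.
rewrite exprMn mulrA (mulrC (_ ^+ 2)); apply; exact/cube_cons.
Qed.

End cube_integral.

(** * Invariance of Lebesgue measure under rigid motions *)

Section lebesgue_rV_invariance.
Variable R : realType.
Notation leb := (@lebesgue_measure R).

(** The image of Lebesgue measure under a translation takes the same values on half-open intervals,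
    hence is Lebesgue measure. *)
Lemma lebesgue_measure_shift (a : R) (g : measurableTypeR R -> \bar R) :
  measurable_fun setT g -> (forall x, 0 <= g x)%E ->
  (\int[leb]_x g (x + a)%R = \int[leb]_x g x)%E.
Proof.
move=> mg g0.
have ma : measurable_fun [set: measurableTypeR R]
    ((fun x => x + a) : measurableTypeR R -> measurableTypeR R).
  exact: measurable_funD.
pose m := pushforward leb ((fun x => x + a) : measurableTypeR R -> measurableTypeR R).
transitivity (\int[m]_x g x)%E.
  by rewrite /m [RHS](ge0_integral_pushforward ma leb measurableT mg).
apply: eq_measure_integral => A mA _.
apply/esym; apply: (@lebesgue_measure_unique R
  (measure_function_pushforward__canonical__measure_function_Measure leb ma)) => //.
move=> X; rewrite /ocitv => -[[u v] _ <-] /=.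
rewrite /pushforward.
have -> : (fun x => x + a) @^-1` [set` `]u, v]] = [set` `]u - a, v - a]] :> set R.
  by apply/seteqP; split => x /=; rewrite !in_itv/= ltrBlDr lerBrDr.
rewrite !lebesgue_measure_itv/= !lte_fin ltrD2r; case: ifPn => // _.
by rewrite -!EFinD; congr EFin; lra.
Qed.

Lemma measurable_rV_lin d (T : measurableType d) n (f h : T -> borel_rV R n) a b :
  measurable_fun setT f -> measurable_fun setT h ->
  measurable_fun setT
    (fun x => a *: (f x : 'rV[R]_n) + b *: (h x : 'rV[R]_n) : borel_rV R n).
Proof.
move=> mf mh; apply: measurable_fun_rV => i.
have -> : (fun x => (a *: (f x : 'rV[R]_n) + b *: (h x : 'rV[R]_n)) 0 i) =
    (fun x => a * (f x : 'rV[R]_n) 0 i + b * (h x : 'rV[R]_n) 0 i).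
  by apply/funext => x; rewrite !mxE.
by apply: measurable_funD; apply: measurable_funM => //;
  apply: measurableT_comp (measurable_fun_coord i) _.
Qed.

Lemma measurable_rV_add d (T : measurableType d) n (f h : T -> borel_rV R n) :
  measurable_fun setT f -> measurable_fun setT h ->
  measurable_fun setT (fun x => (f x : 'rV[R]_n) + (h x : 'rV[R]_n) : borel_rV R n).
Proof.
move=> mf mh; have := measurable_rV_lin 1 1 mf mh.
by under eq_fun do rewrite !scale1r.
Qed.

Lemma measurable_rV_sub d (T : measurableType d) n (f h : T -> borel_rV R n) :
  measurable_fun setT f -> measurable_fun setT h ->
  measurable_fun setT (fun x => (f x : 'rV[R]_n) - (h x : 'rV[R]_n) : borel_rV R n).
Proof.
move=> mf mh; have := measurable_rV_lin 1 (- 1) mf mh.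
by under eq_fun do rewrite scale1r scaleN1r.
Qed.

Lemma measurable_rV_mulmx d (T : measurableType d) n (f : T -> borel_rV R n)
    (U : 'M[R]_n) : measurable_fun setT f ->
  measurable_fun setT (fun x => (f x : 'rV[R]_n) *m U : borel_rV R n).
Proof.
move=> mf; apply: measurable_fun_rV => i.
have -> : (fun x => ((f x : 'rV[R]_n) *m U) 0 i) =
    (fun x => \sum_j (f x : 'rV[R]_n) 0 j * U j i).
  by apply/funext => x; rewrite !mxE.
apply: measurable_sum => j; apply: measurable_funM => //.
exact: measurableT_comp (measurable_fun_coord j) mf.
Qed.

(** Induction on the dimension: each slice is translated by the tail of [v], then the head
    coordinate by [v 0 0]. *)
Lemma lebesgue_rV_shift n (v : 'rV[R]_n) (g : borel_rV R n -> \bar R) :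
  measurable_fun setT g -> (forall x, 0 <= g x)%E ->
  (\int[@lebesgue_rV R n]_x g ((x : 'rV[R]_n) + v)%R =
   \int[@lebesgue_rV R n]_x g x)%E.
Proof.
elim: n v g => [|n IH] v g mg g0.
  apply: eq_integral => x _; congr g; rewrite /= in x *.
  by rewrite [LHS]thinmx0 [RHS]thinmx0.
pose w : 'rV[R]_n := \row_i v 0 (lift ord0 i).
have consD (x : borel_rV R n) s :
    (cons_rV (x, s) : 'rV[R]_n.+1) + v = cons_rV ((x : 'rV[R]_n) + w : borel_rV R n, s + v 0 0).
  apply/rowP => i; rewrite mxE.
  have [j ->|->] := unliftP ord0 i; last by rewrite !cons_rV_ord0.
  by rewrite !cons_rV_lift /= [in RHS]mxE mxE.
have mgv : measurable_fun setT
    (fun x : borel_rV R n.+1 => g ((x : 'rV[R]_n.+1) + v)).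
  apply: measurableT_comp mg _; apply: measurable_rV_add => //.
rewrite !lebesgue_rV_tonelli//.
under eq_integral do under eq_integral do rewrite consD.
under eq_integral => s _.
  rewrite (IH w (fun x => g (cons_rV (x, s + v 0 0)))); last 2 first.
  - apply: measurableT_comp mg _.
    exact: measurableT_comp (@measurable_cons_rV R n) (pair2_measurable _).
  - by [].
  over.
rewrite (lebesgue_measure_shift (v 0 0)
  (g := fun s => (\int[@lebesgue_rV R n]_x g (cons_rV (x, s)))%E))//.
- exact: measurable_fun_slice.
- by move=> s; exact: integral_ge0.
Qed.

End lebesgue_rV_invariance.

Section orthogonal_invariance.
Variable R : realType.

Definition sumsq n (v : 'rV[R]_n) : R := \sum_(i < n) v 0 i ^+ 2.

Lemma sumsqE n (v : 'rV[R]_n) : sumsq v = (v *m v^T) 0 0.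
Proof. by rewrite mxE; apply: eq_bigr => i _; rewrite mxE expr2. Qed.

Lemma sumsqN n (v : 'rV[R]_n) : sumsq (- v) = sumsq v.
Proof. by apply: eq_bigr => i _; rewrite mxE sqrrN. Qed.

Lemma sumsq_orthogonal n (U : 'M[R]_n) (v : 'rV[R]_n) :
  U *m U^T = 1%:M -> sumsq (v *m U) = sumsq v.
Proof.
by move=> UU; rewrite !sumsqE trmx_mul mulmxA -(mulmxA v) UU mulmx1.
Qed.

Lemma measurable_sumsq n : measurable_fun setT (@sumsq n : borel_rV R n -> R).
Proof.
apply: measurable_sum => i; apply: measurable_funX.
exact: measurable_fun_coord.
Qed.

Let ball n : set (borel_rV R n) := [set v | sumsq v <= 1].

Let measurable_ball n : measurable (@ball n).
Proof.
rewrite (_ : @ball n = setT `&` (@sumsq n : borel_rV R n -> R) @^-1` `]-oo, 1]).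
  by apply: measurable_sumsq => //; exact: measurable_itv.
by rewrite setTI; apply/seteqP; split => v; rewrite /ball/= in_itv.
Qed.

Let sym_box n (r : R) : set 'rV[R]_n :=
  [set v | forall i, `[- r, r]%classic (v 0 i)].

Let lebesgue_sym_box n (r : R) : 0 < r ->
  [/\ measurable (@sym_box n r : set (borel_rV R n)),
   (0 < lebesgue_rV (@sym_box n r))%E & (lebesgue_rV (@sym_box n r) < +oo)%E].
Proof.
move=> r0; split.
- apply: (@measurable_preimage_box _ _ _ n id (fun=> `[- r, r]%classic)) => i.
    exact: measurable_fun_coord.
  exact: measurable_itv.
- rewrite [ltRHS](@lebesgue_rV_box R n (fun=> `[- r, r]%classic)); last first.
    by move=> i; exact: measurable_itv.
  apply: (big_ind (fun x : \bar R => 0 < x)%E) => //.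
    by move=> x y; exact: mule_gt0.
  move=> i _; rewrite lebesgue_measure_itv/= lte_fin gtrN// -EFinD lte_fin opprK.
  by rewrite addr_gt0.
- rewrite [ltLHS](@lebesgue_rV_box R n (fun=> `[- r, r]%classic)); last first.
    by move=> i; exact: measurable_itv.
  rewrite ltey_eq; apply/orP; left.
  apply: (big_ind (fun x : \bar R => x \is a fin_num)) => //.
    by move=> x y; exact: fin_numM.
  by move=> i _; rewrite lebesgue_measure_itv/= lte_fin gtrN.
Qed.

Let lebesgue_ball_gt0 n : (0 < lebesgue_rV (@ball n))%E.
Proof.
(* In the box of half-side [1 / (n + 1)] each of the [n] squares is at most [1 / (n + 1)], so the
   box lies in the ball; the successor also covers [n = 0]. *)
have r0 : 0 < n.+1%:R^-1 :> R by rewrite invr_gt0.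
have [mb b0 _] := lebesgue_sym_box n r0.
apply: (lt_le_trans b0); apply: le_measure; rewrite ?inE//.
move=> v vr; rewrite /ball/=.
apply: (@le_trans _ _ (\sum_(i < n) n.+1%:R^-1)).
  apply: ler_sum => i _; have := vr i; rewrite /= in_itv/= => vi.
  have r1 : n.+1%:R^-1 <= 1 :> R by rewrite invf_le1// ler1n.
  move: (n.+1%:R^-1) r0 r1 vi => r r0 r1 vi.
  apply: (@le_trans _ _ (r ^+ 2)); last by rewrite expr2 ler_piMl// ltW.
  by rewrite -[leLHS]real_normK ?num_real// ler_pXn2r ?nnegrE ?(ltW r0)// ler_norml.
rewrite sumr_const card_ord -[leLHS]mulr_natl ler_pdivrMr// mul1r ler_nat.
exact: leqnSn.
Qed.

Let lebesgue_ball_fin n : (lebesgue_rV (@ball n) < +oo)%E.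
Proof.
have [mb _ boo] := lebesgue_sym_box n (@ltr01 R).
apply: le_lt_trans boo; apply: le_measure; rewrite ?inE//.
move=> v; rewrite /ball/= => v1 i; rewrite /= in_itv/= -ler_norml.
rewrite -(@ler_pXn2r _ 2)// ?nnegrE// expr1n real_normK ?num_real//.
apply: le_trans v1; rewrite /sumsq (bigD1 i)//= lerDl.
by apply: sumr_ge0 => j _; exact: sqr_ge0.
Qed.

(* Uniqueness of Haar measure: for translation-invariant [l] and its image [l']
   under [U], [l(g) l'(B) = l'(g) l(-B)], and the unit ball [B] is invariant
   under both [U] and [-1]. *)
Lemma lebesgue_rV_orthogonal n (U : 'M[R]_n) (g : borel_rV R n -> \bar R) :
  U *m U^T = 1%:M -> measurable_fun setT g -> (forall x, 0 <= g x)%E ->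
  (\int[@lebesgue_rV R n]_x g ((x : 'rV[R]_n) *m U) =
   \int[@lebesgue_rV R n]_x g x)%E.
Proof.
move=> UU mg g0.
pose l := @lebesgue_rV R n.
pose b (x : borel_rV R n) : \bar R := (\1_(@ball n) x)%:E.
have b0 x : (0 <= b x)%E by rewrite lee_fin.
have mb : measurable_fun setT b.
  apply/measurable_EFinP; apply: measurable_indic; exact: measurable_ball.
have intb : (\int[l]_x b x = l (@ball n))%E.
  by rewrite integral_indic ?setIT//; exact: measurable_ball.
have bU (y : 'rV[R]_n) : b (y *m U) = b y.
  by rewrite /b !indicE; congr (_%:R)%:E; congr nat_of_bool;
    apply/idP/idP; rewrite !inE /ball/= sumsq_orthogonal.
have bsym (x y : 'rV[R]_n) : b (x - y) = b (y - x).
  by rewrite /b !indicE; congr (_%:R)%:E; congr nat_of_bool;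
    apply/idP/idP; rewrite !inE /ball/= -opprB sumsqN.
have mgU : measurable_fun setT (fun y : borel_rV R n => g ((y : 'rV[R]_n) *m U)).
  by apply: measurableT_comp mg _; exact: measurable_rV_mulmx.
have shiftb (v : 'rV[R]_n) : (\int[l]_x b ((x : 'rV[R]_n) + v)%R = l (@ball n))%E.
  by rewrite (lebesgue_rV_shift v mb b0).
have main : (l (@ball n) * \int[l]_x g x =
    l (@ball n) * \int[l]_x g ((x : 'rV[R]_n) *m U))%E.
  (* For fixed [y], translation invariance removes the shift by [y *m U] from the inner integral. *)
  transitivity (\int[l]_y \int[l]_x (b y * g ((x : 'rV[R]_n) + (y : 'rV[R]_n) *m U)%R))%E.
    rewrite -intb -ge0_integralZr//=; last exact: integral_ge0.
    apply: eq_integral => y _; rewrite ge0_integralZl//=.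
    - by rewrite (lebesgue_rV_shift _ mg g0).
    - apply: measurableT_comp mg _; apply: measurable_rV_add => //.
  transitivity (\int[l]_x \int[l]_y (b y * g ((x : 'rV[R]_n) + (y : 'rV[R]_n) *m U)%R))%E.
    rewrite -(fubini_tonelli (m1 := l) (m2 := l)
      (fun p => b p.2 * g ((p.1 : 'rV[R]_n) + (p.2 : 'rV[R]_n) *m U)%R)%E)//.
    - apply: emeasurable_funM; first exact: measurableT_comp mb measurable_snd.
      apply: measurableT_comp mg _; apply: measurable_rV_add => //.
      exact: measurable_rV_mulmx.
    - by move=> p; rewrite mule_ge0.
  (* Translating [y] by [- (x *m U^T)] turns [x + y *m U] into [y *m U]; by its invariance under
     [U], [b] then takes its value at [y *m U - x]. *)
  transitivity (\int[l]_x \int[l]_y (b ((y : 'rV[R]_n) *m U - (x : 'rV[R]_n))%R *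
      g ((y : 'rV[R]_n) *m U)%R))%E.
    apply: eq_integral => x _.
    rewrite -(lebesgue_rV_shift (- ((x : 'rV[R]_n) *m U^T))
      (g := fun y => (b y * g ((x : 'rV[R]_n) + (y : 'rV[R]_n) *m U)%R)%E)).
    - apply: eq_integral => y _; rewrite mulmxDl mulNmx -mulmxA (mulmx1C UU) mulmx1.
      rewrite [in g _]addrC subrK; congr (_ * _)%E.
      by rewrite -bU mulmxDl mulNmx -mulmxA (mulmx1C UU) mulmx1.
    - apply: emeasurable_funM => //.
      apply: measurableT_comp mg _; apply: measurable_rV_add => //.
      exact: measurable_rV_mulmx.
    - by move=> y; rewrite mule_ge0.
  transitivity (\int[l]_y \int[l]_x (b ((y : 'rV[R]_n) *m U - (x : 'rV[R]_n))%R *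
      g ((y : 'rV[R]_n) *m U)%R))%E.
    rewrite (fubini_tonelli (m1 := l) (m2 := l)
      (fun p => b ((p.2 : 'rV[R]_n) *m U - (p.1 : 'rV[R]_n))%R *
        g ((p.2 : 'rV[R]_n) *m U)%R)%E)//.
    - apply: emeasurable_funM; last exact: measurableT_comp mgU measurable_snd.
      apply: measurableT_comp mb _; apply: measurable_rV_sub => //.
      exact: measurable_rV_mulmx.
    - by move=> p; rewrite mule_ge0.
  (* By symmetry of the ball, the inner integral in [x] is the measure of a translate of the
     ball. *)
  rewrite -ge0_integralZl//=.
  apply: eq_integral => y _; rewrite ge0_integralZr//=.
  - congr (_ * _)%E; rewrite -(shiftb (- ((y : 'rV[R]_n) *m U))).
    by apply: eq_integral => x _; rewrite bsym.
  - by apply: measurableT_comp mb _; apply: measurable_rV_sub.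
(* The measure of the ball is finite and positive, so it cancels from [main]. *)
have lfin : l (@ball n) \is a fin_num.
  by rewrite ge0_fin_numE//; exact: lebesgue_ball_fin.
have lpos : 0 < fine (l (@ball n)) by rewrite fine_gt0// lebesgue_ball_gt0 lebesgue_ball_fin.
move: main; rewrite -(fineK lfin) => /(congr1 (fun x => (fine (l (@ball n)))^-1%:E * x)%E).
by rewrite !muleA -!EFinM mulVf ?gt_eqF// !mul1e.
Qed.

Lemma lebesgue_rV_rigid n (a : 'rV[R]_n) (U : 'M[R]_n) (g : borel_rV R n -> \bar R) :
  U *m U^T = 1%:M -> measurable_fun setT g -> (forall x, 0 <= g x)%E ->
  (\int[@lebesgue_rV R n]_x g (a + (x : 'rV[R]_n) *m U)%R =
   \int[@lebesgue_rV R n]_x g x)%E.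
Proof.
move=> UU mg g0; rewrite -(lebesgue_rV_shift a mg g0).
rewrite -(lebesgue_rV_orthogonal (g := fun x => g ((x : 'rV[R]_n) + a)%R) UU)//.
- by apply: eq_integral => x _; rewrite addrC.
- by apply: measurableT_comp mg _; apply: measurable_rV_add.
Qed.

End orthogonal_invariance.

(** * Concentration *)

(** Exponential of the log-concavity inequality at [s = 1/2]; a zero of [f] at [x] or [y] makes the
    left side vanish. *)
Lemma midpoint_log_concave (R : realType) n (Q : set 'rV[R]_n) (f : 'rV[R]_n -> R) x y :
  log_concave Q f -> (forall z, Q z -> 0 <= f z) -> Q x -> Q y ->
  f x * f y <= f (2^-1 *: x + 2^-1 *: y) ^+ 2.
Proof.
move=> lcf f0 Qx Qy.
have [fx0|fx0] := eqVneq (f x) 0; first by rewrite fx0 mul0r sqr_ge0.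
have [fy0|fy0] := eqVneq (f y) 0; first by rewrite fy0 mulr0 sqr_ge0.
have {}fx0 : 0 < f x by rewrite lt_neqAle eq_sym fx0 f0.
have {}fy0 : 0 < f y by rewrite lt_neqAle eq_sym fy0 f0.
have half : 1 - 2^-1 = 2^-1 :> R by lra.
have := lcf x y 2^-1 Qx Qy ltac:(lra); rewrite half.
(* If [f] were at most 0 at the midpoint, the left side would be [+oo] and the right side finite. *)
rewrite /lne (lt_geF fx0) (lt_geF fy0)/=; case: (leP (f _) 0) => // fm0.
rewrite -!EFinN -!EFinM -EFinD lee_fin => h.
rewrite -ler_ln ?posrE ?mulr_gt0 ?exprn_gt0// lnM ?posrE// lnXn//.
rewrite mulr2n; lra.
Qed.

(** In the head coordinate the function lies below its chord between two opposite faces, which are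
    cubes of one dimension less. This provides the bound that [cube_fun] asks of the density. *)
Lemma convex_on_cube_bounded (R : realType) n (H : 'rV[R]_n -> R) :
  convex_on_cube H -> exists M, forall x, cube R n x -> H x <= M.
Proof.
elim: n H => [|n IH] H cH.
  by exists (H 0) => x _; rewrite [x]thinmx0.
have c0 : 0 <= (0 : R) <= 1 by lra.
have c1 : 0 <= (1 : R) <= 1 by lra.
have [M0 HM0] := IH _ (convex_on_slice c0 cH).
have [M1 HM1] := IH _ (convex_on_slice c1 cH).
exists (Num.max M0 M1) => x xc.
pose x' : 'rV[R]_n := \row_i x 0 (lift ord0 i).
have xE : x = x 0 0 *: (cons_rV (x' : borel_rV R n, 1) : 'rV[R]_n.+1) +
    (1 - x 0 0) *: (cons_rV (x' : borel_rV R n, 0) : 'rV[R]_n.+1).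
  rewrite cons_rV_linear mulr1 mulr0 addr0 -scalerDl subrKC scale1r.
  apply/rowP => i; have [j ->|->] := unliftP ord0 i; last by rewrite cons_rV_ord0.
  by rewrite cons_rV_lift /= mxE.
have xc' : cube R n x' by move=> i; rewrite mxE.
have /andP[x0 x1] := xc 0.
rewrite xE; apply: le_trans (cH _ _ _ _ _ (xc 0)) _; [exact/cube_cons..|].
have h0 := HM0 _ xc'; have h1 := HM1 _ xc'; rewrite /slice in h0 h1.
have m0 : M0 <= Num.max M0 M1 by rewrite le_max lexx.
have m1 : M1 <= Num.max M0 M1 by rewrite le_max lexx orbT.
move: (Num.max _ _) (H _) (H _) (x 0 0) x0 x1 h0 h1 m0 m1 => M a b s s0 s1 h0 h1 m0 m1.
nra.
Qed.

Lemma continuous_sumsq_sub (R : realType) n (y : 'rV[R]_n) :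
  continuous (fun x : 'rV[R]_n => sumsq (x - y)).
Proof.
move=> x; rewrite /continuous_at /sumsq.
elim: (index_enum _) => [|i s IHs].
  have -> : (fun v : 'rV[R]_n => \sum_(i <- [::]) (v - y) 0 i ^+ 2) = cst 0.
    by apply/funext => v; rewrite big_nil.
  by rewrite big_nil; exact: (@cvg_cst _ _ _ (nbhs x)).
have -> : (fun v : 'rV[R]_n => \sum_(j <- i :: s) (v - y) 0 j ^+ 2) =
    (fun v => (v - y) 0 i ^+ 2 + \sum_(j <- s) (v - y) 0 j ^+ 2).
  by apply/funext => v; rewrite big_cons.
rewrite big_cons.
have hx : (fun v : 'rV[R]_n => v 0 i) @ x --> (x 0 i : R).
  exact: (@coord_continuous R 1 n 0 i).
have hy : (fun v : 'rV[R]_n => y 0 i) @ x --> (y 0 i : R).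
  exact: (@cvg_cst _ _ _ (nbhs x)).
have h : (fun v : 'rV[R]_n => (v - y) 0 i) @ x --> (x - y) 0 i.
  have -> : (fun v : 'rV[R]_n => (v - y) 0 i) = (fun v => v 0 i - y 0 i).
    by apply/funext => v; rewrite !mxE.
  by rewrite !mxE; exact: (cvgB hx hy).
have h2 : (fun v : 'rV[R]_n => (v - y) 0 i ^+ 2) @ x --> (x - y) 0 i ^+ 2.
  have -> : (fun v : 'rV[R]_n => (v - y) 0 i ^+ 2) =
    (fun v => (v - y) 0 i * (v - y) 0 i) by [].
  by rewrite expr2; have := cvgM h h; apply.
by have := cvgD h2 IHs; apply.
Qed.

Section ball_neighborhood.
Variables (R : realType) (n : nat) (A : set 'rV[R]_n) (t : R).
Hypothesis t0 : 0 < t.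

(** The strict inequality makes this a union of open balls, hence Borel; it is the measurable subset
    of [enlargement A t] that bounds the inner measure from below. *)
Definition open_enlargement : set 'rV[R]_n :=
  [set x | exists2 y, A y & sumsq (x - y) < t ^+ 2].

Lemma open_enlargement_measurable :
  measurable (open_enlargement : set (borel_rV R n)).
Proof.
apply: sub_sigma_algebra => /=.
have -> : open_enlargement =
    \bigcup_(y in A) ((fun x => sumsq (x - y)) @^-1` [set r | r < t ^+ 2]).
  by apply/seteqP; split => [x [y Ay xy]|x [y Ay xy]]; exists y.
apply: bigcup_open => y Ay; apply: (@open_comp 'rV[R]_n R); last exact: open_lt.
by move=> x _; exact: continuous_sumsq_sub.
Qed.

Lemma sub_open_enlargement : A `<=` open_enlargement.
Proof.
move=> x Ax; exists x => //; rewrite subrr /sumsq big1 ?exprn_gt0// => i _.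
by rewrite mxE expr0n.
Qed.

Lemma open_enlargement_sub : open_enlargement `<=` enlargement A t.
Proof.
move=> x [y Ay xy]; exists y => //; exists (t^-1 *: (x - y)).
  rewrite /= /enorm -[leRHS]sqrtr1 ler_wsqrtr//.
  have -> : \sum_(i < n) (t^-1 *: (x - y)) 0 i ^+ 2 = t ^- 2 * sumsq (x - y).
    by rewrite mulr_sumr; apply: eq_bigr => i _; rewrite mxE exprMn exprVn.
  by rewrite mulrC ler_pdivrMr ?exprn_gt0// mul1r ltW.
by rewrite scalerA mulfV ?gt_eqF// scale1r addrC subrK.
Qed.

End ball_neighborhood.

(** * The density in the coordinates of the standard cube *)

Section cube_density.
Variables (R : realType) (n : nat) (a : 'rV[R]_n) (U : 'M[R]_n).
Hypothesis UU : U *m U^T = 1%:M.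
Variables (f : 'rV[R]_n -> R).

Let psi (u : 'rV[R]_n) : 'rV[R]_n := a + u *m U.
Let Q : set 'rV[R]_n := [set psi u | u in cube R n].

Let psiK u : (psi u - a) *m U^T = u.
Proof. by rewrite /psi addrAC subrr add0r -mulmxA UU mulmx1. Qed.

Let psi_cube u : Q (psi u) <-> cube R n u.
Proof.
split=> [[v vc /(congr1 (fun x => (x - a) *m U^T))]|]; last by exists u.
by rewrite !psiK => <-.
Qed.

Let measurable_psi : measurable_fun setT (psi : borel_rV R n -> borel_rV R n).
Proof.
apply: measurable_rV_add; first exact: measurable_cst.
exact: measurable_rV_mulmx.
Qed.

Let measurable_Q : measurable (Q : set (borel_rV R n)).
Proof.
have -> : Q = setT `&`
    (fun x : borel_rV R n => ((x : 'rV[R]_n) - a) *m U^T : borel_rV R n) @^-1` cube R n.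
  rewrite setTI; apply/seteqP; split => [x [u uc <-]|x xc /=]; first by rewrite /= psiK.
  exists ((x - a) *m U^T) => //.
  by rewrite /psi -mulmxA (mulmx1C UU) mulmx1 addrC subrK.
apply: measurable_rV_mulmx; [|exact: measurableT|exact: measurable_cube].
by apply: measurable_rV_sub.
Qed.

(** [f] is unconstrained outside [Q]; extension by zero makes the pulled-back density measurable on
    the whole space and supported in the cube. *)
Let H (u : borel_rV R n) : R := (f \_ Q) (psi u).

Hypothesis mf : measurable_fun (Q : set (borel_rV R n)) (f : borel_rV R n -> R).
Hypothesis f0 : forall x, Q x -> 0 <= f x.

Let Hin u : cube R n u -> H u = f (psi u).
Proof. by move=> uc; rewrite /H patchE mem_set//; exact/psi_cube. Qed.

Let Hout u : ~ cube R n u -> H u = 0.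
Proof. by move=> uc; rewrite /H patchE memNset// => /psi_cube. Qed.

Let H0 u : 0 <= H u.
Proof.
have [uc|uc] := pselect (cube R n u); last by rewrite Hout.
by rewrite Hin// f0//; exact/psi_cube.
Qed.

Let mfQ : measurable_fun setT (f \_ Q : borel_rV R n -> R).
Proof. exact/(measurable_restrictT _ measurable_Q). Qed.

Let mH : measurable_fun setT H.
Proof. exact: measurableT_comp mfQ measurable_psi. Qed.

Let psi_lin s x y : psi (s *: x + (1 - s) *: y) = s *: psi x + (1 - s) *: psi y.
Proof.
rewrite /psi mulmxDl -!scalemxAl !scalerDr addrACA -scalerDl subrKC scale1r//.
Qed.

Let convex_H : convex_function Q f -> convex_on_cube H.
Proof.
move=> cf x y s xc yc s01; have /andP[s0 s1] := s01.
have xyc : cube R n (s *: x + (1 - s) *: y).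
  by move=> i; rewrite !mxE; have := xc i; have := yc i; nra.
rewrite !Hin// psi_lin.
have := cf (Itv01 s0 s1) (psi x) (psi y).
by rewrite !inE => /(_ ((psi_cube x).2 xc) ((psi_cube y).2 yc)).
Qed.

Let cube_fun_H N : (forall u, cube R n u -> H u <= N) -> cube_fun (Num.max 0 N) H.
Proof.
move=> HN; split=> [//|u|//]; rewrite H0/= le_max.
by have [uc|uc] := pselect (cube R n u); [rewrite HN// orbT|rewrite Hout// lexx].
Qed.

Let cube_fun_indic N (c : R) (E : set (borel_rV R n)) : cube_fun N H -> 1 <= c ->
  measurable E -> cube_fun (c * N) (fun u => c * (\1_E (psi u) * H u)).
Proof.
move=> HN c1 mE; have c0 : 0 <= c by exact: le_trans c1.
apply: cube_funZ => //; case: HN => mH' H0N Hc; split.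
- apply: measurable_funM => //.
  apply: measurableT_comp measurable_psi; exact: measurable_indic.
- move=> u; have /andP[h0 hN] := H0N u; rewrite indicE.
  by case: (_ \in _); rewrite ?mul1r ?mul0r ?H0N// lexx (le_trans h0).
- by move=> u uc; rewrite Hc// mulr0.
Qed.

(** Rigid motions preserve Lebesgue measure, so masses can be computed in cube coordinates. *)
Let indic_density (mu : set (borel_rV R n) -> \bar R) N E :
  cube_fun N H -> measurable E ->
  (forall E : set (borel_rV R n), measurable E ->
    mu E = (\int[@lebesgue_rV R n]_(x in E `&` Q) (f x)%:E)%E) ->
  mu E = (cube_int (fun u => \1_E (psi u) * H u))%:E.
Proof.
move=> HN mE muE.
have hE := cube_fun_indic HN (lexx 1) mE.
have {}hE : cube_fun N (fun u => \1_E (psi u) * H u).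
  by move: hE; rewrite mul1r; under eq_fun do rewrite mul1r.
rewrite (cube_intE hE) muE//.
rewrite integral_mkcond -(lebesgue_rV_rigid a (g := (fun x => (f x)%:E) \_ (E `&` Q))%E UU).
- apply: eq_integral => u _; rewrite /H !patchE indicE in_setI.
  by case: (_ \in E); case: (_ \in Q); rewrite ?mul1r ?mul0r.
- apply/(measurable_restrictT _ (measurableI _ _ mE measurable_Q)).
  by apply/measurable_EFinP; exact: measurable_funS mf.
- move=> x; rewrite patchE; case: ifPn => //; rewrite inE => -[_ Qx].
  by rewrite lee_fin f0.
Qed.

(** [prekopa_cube] is applied to the density restricted to [A] and multiplied by [c = exp (2/9 d)],
    to its restriction to [B], and to the density itself, of integral 1. For [x] in [A] and [y] in
    [B], [c] is at most [exp (2/9 |x - y|^2)], and midpoint log-concavity does the rest. *)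
Lemma separated_density_le (mu : probability (borel_rV R n) R)
    (A B : set (borel_rV R n)) (d : R) :
  log_concave Q f -> convex_function Q f ->
  (forall E : set (borel_rV R n), measurable E ->
    mu E = (\int[@lebesgue_rV R n]_(x in E `&` Q) (f x)%:E)%E) ->
  measurable A -> measurable B -> 0 <= d ->
  (forall x y : 'rV[R]_n, A x -> B y -> d <= sumsq (x - y)) ->
  fine (mu A) * fine (mu B) <= expR (- (2 / 9 * d)).
Proof.
move=> lcf cf muE mA mB d0 AB.
have cH := convex_H cf.
have [N HN] := convex_on_cube_bounded cH.
have {}HN := cube_fun_H HN; set M := Num.max 0 N in HN.
pose c := expR (2 / 9 * d).
have c1 : 1 <= c by rewrite -expR0 ler_expR mulr_ge0.
have c0 : 0 <= c by exact: le_trans c1.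
have M0 := cube_fun_ge0 HN.
have McM : M <= c * M by rewrite ler_peMl.
have hA := cube_fun_indic HN c1 mA.
have hB := cube_fun_indic HN (lexx 1) mB; rewrite mul1r in hB.
have hA1 := cube_fun_indic HN (lexx 1) mA; rewrite mul1r in hA1.
have {}hB : cube_fun M (fun u => \1_B (psi u) * H u).
  by move: hB; under eq_fun do rewrite mul1r.
have {}hA1 : cube_fun M (fun u => \1_A (psi u) * H u).
  by move: hA1; under eq_fun do rewrite mul1r.
have JH : cube_int H = 1.
  have := indic_density HN measurableT muE; rewrite probability_setT => -[->].
  by congr cube_int; apply/funext => u; rewrite indicT mul1r.
rewrite (indic_density HN mA muE) (indic_density HN mB muE) /=.
suff : c * (cube_int (fun u => \1_A (psi u) * H u) *
    cube_int (fun u => \1_B (psi u) * H u)) <= 1.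
  by rewrite expRN -/c -[c^-1]mul1r ler_pdivlMr ?expR_gt0// mulrC.
rewrite mulrA -(cube_intZ hA1 c0) -[leRHS](expr1n _ 2) -JH.
apply: (prekopa_cube (N := c * M)) => //.
- exact: cube_funW hB McM.
- exact: cube_funW HN McM.
move=> x y xc yc.
have half : 2^-1 = 1 - 2^-1 :> R by lra.
have mid : H (2^-1 *: x + 2^-1 *: y) = f (2^-1 *: psi x + 2^-1 *: psi y).
  rewrite {2 4}half -psi_lin -half Hin// => i; rewrite !mxE.
  by have := xc i; have := yc i; lra.
rewrite !indicE mid.
have [/set_mem Ax|_] := boolP (psi x \in A); last first.
  by rewrite mul0r mulr0 mul0r mulr_ge0 ?sqr_ge0// expR_ge0.
have [/set_mem By|_] := boolP (psi y \in B); last first.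
  by rewrite mul0r mulr0 mulr_ge0 ?sqr_ge0// expR_ge0.
rewrite !mul1r -mulrA mulrC !Hin//.
apply: ler_pM; rewrite ?mulr_ge0 ?f0//; try exact/psi_cube.
  by apply: (midpoint_log_concave lcf f0); exact/psi_cube.
rewrite ler_expR ler_wpM2l//.
have -> : \sum_(i < n) (x 0 i - y 0 i) ^+ 2 = sumsq (psi x - psi y).
  rewrite /psi opprD addrACA subrr add0r -mulmxBl sumsq_orthogonal//.
  by apply: eq_bigr => i _; rewrite !mxE.
exact: AB.
Qed.

End cube_density.

Theorem corollary1p3 (R : realType) (n : nat) (Q : set 'rV[R]_n)
    (mu : probability (borel_rV R n) R) (f : 'rV[R]_n -> R) :
  unit_cube Q ->
  has_density mu Q f ->
  log_concave Q f ->
  convex_function Q f ->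
  forall (A : set 'rV[R]_n) (t : R),
    measurable (A : set (borel_rV R n)) -> 0 < t ->
    ((2^-1)%:E <= mu A)%E ->
    ((1 - expR (- (t ^+ 2 / 9)))%:E <= inner_measure mu (enlargement A t))%E.
Proof.
move=> [a [U [UU ->]]] [mf f0 muE] lcf cf A t mA t0 muA.
pose E := open_enlargement A t.
have mE : measurable (E : set (borel_rV R n)) := open_enlargement_measurable A t.
apply: (@le_trans _ _ (mu E)); last first.
  apply: ereal_sup_ubound; exists E => //; split => //.
  exact: open_enlargement_sub.
have AE : (mu A <= mu E)%E.
  by apply: le_measure; rewrite ?inE//; exact: sub_open_enlargement.
have muEC : mu E = (1 - fine (mu (~` E)))%:E.
  rewrite probability_setC// -[LHS]fineK; last exact: fin_num_measure.
  by rewrite -[X in (1 - X)%E]fineK ?fin_num_measure//= subKr.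
pose q := expR (- (t ^+ 2 / 9)).
(* For [q >= 1/2] the claim already follows from [mu A >= 1/2], since [A] lies in [E]. *)
have [q2|q2] := leP 2^-1 q.
  apply: le_trans AE; apply: le_trans muA.
  by rewrite lee_fin -/q; lra.
(* Points outside [E] are at distance at least [t] from all of [A]; the bound obtained is
   [exp (- 2/9 t^2) = q ^+ 2]. *)
have sep := @separated_density_le R n a U UU f mf f0 mu (~` E) A (t ^+ 2) lcf cf muE
  (measurableC mE) mA (sqr_ge0 t).
have {}sep : fine (mu (~` E)) * fine (mu A) <= q ^+ 2.
  rewrite expr2 -expRD.
  have -> : - (t ^+ 2 / 9) + - (t ^+ 2 / 9) = - (2 / 9 * t ^+ 2) by field.
  apply: sep => x y xE Ay; rewrite leNgt; apply/negP => xy.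
  by apply: xE; exists y.
have A2 : 2^-1 <= fine (mu A).
  by rewrite -lee_fin fineK//; exact: fin_num_measure.
have p0 : 0 <= fine (mu (~` E)) by rewrite fine_ge0.
have q0 : 0 < q by exact: expR_gt0.
rewrite muEC lee_fin -/q lerD2l lerN2.
have h : fine (mu (~` E)) * 2^-1 <= q ^+ 2.
  by apply: le_trans sep; rewrite ler_wpM2l.
(* The far set has mass at most [2 * q ^+ 2], which is at most [q] because [q < 1/2]; this trades
   the exponent [2/9] for [1/9]. *)
move: h; rewrite expr2; nra.
Qed.
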